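(* Let $\lambda\in\mathbb R\setminus\{0\}$, let $n>1$, let $Q_1,Q_2$ be non-zero real homogeneous polynomials of degree $n$, and consider the system $\dot x=\lambda x+Q_1(x,y)$, $\dot y=\lambda y+Q_2(x,y)$. Its dynamics exhibits a polycycle if and only if $n$ is odd, there is at least one pair of infinite equilibria, and $\lambda f(\theta)<0$ whenever $g(\theta)=0$. Moreover, the polycycle is globally attracting if $\lambda>0$ (respectively globally repelling if $\lambda<0$).
   Context: $f(\theta)=\cos\theta\,Q_1(\cos\theta,\sin\theta)+\sin\theta\,Q_2(\cos\theta,\sin\theta)$ and $g(\theta)=\cos\theta\,Q_2(\cos\theta,\sin\theta)-\sin\theta\,Q_1(\cos\theta,\sin\theta)$, so that in polar coordinates the system is $\dot r=\lambda r+f(\theta)r^n$, $\dot\theta=g(\theta)r^{n-1}$. Infinite equilibria are the equilibria on the circle at infinity of the Poincaré disk; they correspond to the zeros $\theta_0\in\mathbb R/2\pi\mathbb Z$ of $g$ and occur in pairs $\theta_0,\theta_0+\pi$. A polycycle is a flow-invariant simple closed curve in the plane containing at least one equilibrium point and not going through the origin. Globally attracting (repelling) means that every trajectory other than the origin accumulates on it in forward (backward) time. *)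

(* Defs.v *)
From HB Require Import structures.
From mathcomp Require Import all_boot all_order all_algebra.
From mathcomp Require Import all_classical all_reals all_analysis.
(* the notations of mpoly clash with those of mathcomp-analysis *)
From mathcomp Require Import -(notations) mpoly.

Set Implicit Arguments.
Unset Strict Implicit.
Unset Printing Implicit Defensive.

Import Order.TTheory GRing.Theory Num.Theory numFieldNormedType.Exports.

Local Open Scope classical_set_scope.
Local Open Scope ring_scope.

Notation bipoly R := (mpoly 2 R).

Definition homogeneous (R : realType) (d : nat) (Q : bipoly R) : bool :=
  Q \is ishomog1 d (@mdeg 2).

Definition eval2 (R : realType) (Q : bipoly R) (p : R * R) : R :=
  meval (tnth [tuple p.1; p.2]) Q.

Section AutonomousPlanarODE.
Context {R : realType}.
Implicit Types (F : R * R -> R * R) (I : set R) (u : R -> R * R).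

Definition solution F I u : Prop :=
  [/\ open I, is_interval I & forall t, I t -> is_derive t 1 u (F (u t))].

(* Only the values of u on I are meaningful. *)
Definition trajectory F I u : Prop :=
  [/\ I !=set0, solution F I u &
      forall J v, solution F J v -> I `<=` J ->
        (forall t, I t -> v t = u t) -> J `<=` I].

Definition flow_invariant F (C : set (R * R)) : Prop :=
  forall I u, trajectory F I u ->
    forall s t, I s -> I t -> C (u s) -> C (u t).

Definition simple_closed_curve (C : set (R * R)) : Prop :=
  exists c : R -> R * R,
    [/\ {within `[0, 1], continuous c}, c 0 = c 1,
        {in `[0, 1[ &, injective c} & C = c @` `[0, 1]].

Definition polycycle F (C : set (R * R)) : Prop :=
  [/\ simple_closed_curve C, flow_invariant F C,
      exists2 p, C p & F p = 0 & ~ C 0].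

(* The trajectory is defined for all large times and the distance from u t
   to C tends to 0; for compact C this says that the omega-limit set is
   nonempty and contained in C. *)
Definition forward_asymptotic I u (C : set (R * R)) : Prop :=
  (\forall t \near +oo, I t) /\
  (forall e : R, 0 < e -> \forall t \near +oo, exists2 q, C q & `|u t - q| < e).

Definition backward_asymptotic I u (C : set (R * R)) : Prop :=
  (\forall t \near -oo, I t) /\
  (forall e : R, 0 < e -> \forall t \near -oo, exists2 q, C q & `|u t - q| < e).

Definition globally_attracting F (C : set (R * R)) : Prop :=
  forall I u, trajectory F I u -> (exists2 t, I t & u t != 0) ->
    forward_asymptotic I u C.

Definition globally_repelling F (C : set (R * R)) : Prop :=
  forall I u, trajectory F I u -> (exists2 t, I t & u t != 0) ->
    backward_asymptotic I u C.

End AutonomousPlanarODE.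

Section System.
Context {R : realType}.
Variables (lam : R) (n : nat) (Q1 Q2 : bipoly R).

Definition system_field (p : R * R) : R * R :=
  (lam * p.1 + eval2 Q1 p, lam * p.2 + eval2 Q2 p).

Definition unit_vec (th : R) : R * R := (cos th, sin th).

(* In polar coordinates the system reads
     r' = lam r + radial_part th * r^n,  th' = angular_part th * r^(n-1). *)
Definition radial_part (th : R) : R :=
  cos th * eval2 Q1 (unit_vec th) + sin th * eval2 Q2 (unit_vec th).

Definition angular_part (th : R) : R :=
  cos th * eval2 Q2 (unit_vec th) - sin th * eval2 Q1 (unit_vec th).

(* The Poincaré compactification.  Under the diffeomorphism
   p |-> X = p / sqrt (1 + |p|^2) onto the open unit disk, and with
   z = sqrt (1 - |X|^2), so that p = X / z, the field lam p + Q(p) is pushed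
   forward to z^(1-n) times
     lam z^(n+1) X + Q(X) - (X . Q(X)) X,
   where Q = (Q1, Q2) has degree n and . is the dot product.  Dropping the
   positive factor z^(1-n) leaves a field that extends to the closed disk and
   is tangent to the circle |X| = 1. *)
Definition poincare_field (X : R * R) : R * R :=
  let z := Num.sqrt (1 - (X.1 ^+ 2 + X.2 ^+ 2)) in
  let XQ := X.1 * eval2 Q1 X + X.2 * eval2 Q2 X in
  (lam * z ^+ n.+1 * X.1 + eval2 Q1 X - XQ * X.1,
   lam * z ^+ n.+1 * X.2 + eval2 Q2 X - XQ * X.2).

Definition infinite_equilibrium (th : R) : Prop :=
  poincare_field (unit_vec th) = 0.

End System.

(* Main.v *)
Require Import Defs.
From HB Require Import structures.
From mathcomp Require Import all_boot all_order all_algebra.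
From mathcomp Require Import all_classical all_reals all_analysis.
From mathcomp Require Import ring lra.
From mathcomp Require Import -(notations) mpoly.
Import Order.TTheory GRing.Theory Num.Theory numFieldNormedType.Exports.
Local Open Scope classical_set_scope.
Local Open Scope ring_scope.

(** Write the system as x' = lam x + q(x) with q homogeneous of degree
n = m + 1, and suppose lam > 0; reversing time exchanges (lam, q) with
(- lam, - q), attraction with repulsion, and leaves lam f alone.

Up to the substitution z = e^(- lam t) x, sigma = e^(mu t) with mu = m lam, the
system is the autonomous homogeneous system dz/dsigma = q(z) / mu.  That system
is invariant under translations of sigma and under scaling, so the original one
has a symmetry that moves a solution along the rays: if u is a solution, so is
  t |-> kap e^(lam (t - s)) u(s),   e^(mu s) = 1 + kap^m (e^(mu t) - 1),
which starts at kap u(0) (lemma rescaled_solution).  This symmetry replaces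
the usual index and Poincaré-Bendixson arguments.

A compact invariant set C that misses the origin meets each ray at most once:
solutions in C are global, bounded, and bounded away from 0, but if kap > 1 the
displayed solution explodes in finite negative time, where the right-hand side
of the equation for s vanishes (invariant_meets_ray_once).  In the other time
direction kap e^(lam (t - s)) tends to 1, so the solution through kap p is
attracted by the one through p; if C meets every ray, it attracts everything
but the origin (invariant_attracting).

A simple closed curve that meets each ray at most once meets every ray, since
otherwise the stereographic projection from the missing direction would embed
it in a line (closed_curve_meets_every_ray).  So a polycycle meets each ray
exactly once.  If g(th) = 0, the ray in direction th is invariant, and the
point of the polycycle on it cannot move: it is an equilibrium r e_th, with
lam r + f(th) r^n = 0, whence lam f(th) < 0 (invariant_ray_equilibrium).  For
even n the values of f at th and th + pi are opposite, so n is odd; the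
equilibrium on the polycycle provides a zero of g.

Conversely, suppose that g has a zero and that f is negative at its zeros, and
let C be the set of the points whose orbit stays in a fixed annulus
for all times.  It is compact and invariant, so it meets each ray at most once,
and a compact set that meets each ray exactly once is a simple closed curve
(star_shaped_closed_curve).  It remains to find an orbit in the annulus from
each direction.  Follow the angle th' = g(th) and the logarithm y' = f(th) of
the radius of the homogeneous system.  By compactness f <= - c + A |g| between
a zero of g and its next copy, where the angle is trapped; as |g(th)| is plus
or minus th', its integral is at most 2 pi, and y(t) - y(s) <= - c (t - s) + K
(dissipative_along_flow).  So the integral S(t) of e^(- m y) from - oo to t
converges: the homogeneous solution comes from infinity at a finite time.  Once
that time is taken as the origin of sigma, the corresponding solution of the system
has radius (mu S e^(m y))^(1/m), which lies between two positive constants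
(ancient_orbits). *)

(** * Derivatives and primitives *)

Lemma is_deriveE {R : realType} {V : normedModType R} (f : R -> V) (t : R) (l : V) :
  is_derive t 1 f l <-> h^-1 *: (f (h + t) - f t) @[h --> 0^'] --> l.
Proof.
have E : (fun h : R => h^-1 *: ((f \o shift t) (h *: (1:R)) - f t)) =
         (fun h => h^-1 *: (f (h + t) - f t)).
  by apply/funext => h /=; rewrite [h%:A]mulr1.
split => [[df dl]|dl].
  by rewrite -E -dl; exact: df.
by rewrite -E in dl; split; [apply/cvg_ex; exists l | exact/cvg_lim].
Qed.

Lemma is_derive_pairE {R : realType} (u : R -> R * R) (t : R) (l : R * R) :
  is_derive t 1 u l <->
  is_derive t 1 (fun s => (u s).1) l.1 /\ is_derive t 1 (fun s => (u s).2) l.2.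
Proof.
rewrite !is_deriveE; split => [dl|[d1 d2]].
  by split; [exact: (cvg_comp _ _ dl cvg_fst)|exact: (cvg_comp _ _ dl cvg_snd)].
by case: l d1 d2 => l1 l2 d1 d2; exact: (cvg_pair d1 d2).
Qed.

Lemma is_derive_continuous {R : realType} {V : normedModType R} (u : R -> V) (t : R) (l : V) :
  is_derive t 1 u l -> {for t, continuous u}.
Proof. by case=> /derivable1_diffP /differentiable_continuous. Qed.

Lemma derive_nonincreasing {R : realType} (f df : R -> R) (a b : R) : a <= b ->
  (forall t, a <= t <= b -> is_derive t 1 f (df t)) ->
  (forall t, a <= t <= b -> df t <= 0) -> f b <= f a.
Proof.
move=> ab dfE df0.
have [||c cab E] := @MVT_segment R f df a b ab.
- by move=> x; rewrite in_itv /= => /andP[/ltW ? /ltW ?]; apply: dfE; apply/andP.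
- apply: derivable_within_continuous => x; rewrite in_itv /= => xab.
  by have [] := dfE _ xab.
rewrite in_itv /= in cab.
by rewrite -subr_le0 E mulr_le0_ge0 ?subr_ge0 // df0.
Qed.

Lemma derive_nondecreasing {R : realType} (f df : R -> R) (a b : R) : a <= b ->
  (forall t, a <= t <= b -> is_derive t 1 f (df t)) ->
  (forall t, a <= t <= b -> 0 <= df t) -> f a <= f b.
Proof.
move=> ab dfE df0.
rewrite -lerN2.
apply: (@derive_nonincreasing _ (- f) (- df) _ _ ab) => t tab; rewrite ?oppr_le0 ?df0 //.
by have ? := dfE _ tab; exact: is_deriveN.
Qed.

Lemma derive_eq0_eq {R : realType} (f : R -> R) (a b : R) : a <= b ->
  (forall t, a <= t <= b -> is_derive t 1 f 0) -> f a = f b.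
Proof.
move=> ab df; apply/eqP; rewrite eq_le.
by rewrite (@derive_nondecreasing _ f (cst 0)) // (@derive_nonincreasing _ f (cst 0)).
Qed.

(** The fundamental theorem of calculus gives a two-sided derivative only to the
right of the lower bound of integration. *)
Lemma primitive_above {R : realType} (f : R -> R) (a : R) : continuous f ->
  exists P : R -> R, forall x : R, a < x -> is_derive x 1 P (f x).
Proof.
move=> cf; exists (fun y => (\int[lebesgue_measure]_(t in `[a, y]) f t)%R) => x ax.
have [||||d dE] := @continuous_FTC1_closed R f a x (x + 1).
- by rewrite ltrDl.
- apply: continuous_compact_integrable; first exact: segment_compact.
  by apply: continuous_subspaceT => ?; exact: cf.
- exact: ax.
- exact: cf.
apply: DeriveDef; first exact: d.
by rewrite -derive1E; exact: dE.
Qed.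

(** Integrate from a lower bound that depends on the point and lies to its left;
the primitives obtained from two lower bounds agree once they vanish at 0. *)
Lemma primitive_exists {R : realType} (f : R -> R) : continuous f ->
  exists2 P : R -> R, P 0 = 0 & forall x : R, is_derive x 1 P (f x).
Proof.
move=> cf.
have /choice[P PE] : forall a : R, exists P : R -> R,
    P 0 = 0 /\ forall x : R, a < x -> is_derive x 1 P (f x).
  move=> a; have [P dP] := primitive_above f a cf.
  exists (fun x => P x - P 0); split; first by rewrite subrr.
  move=> x ax; have ? := dP x ax.
  by apply: is_derive_eq; rewrite subr0.
have P0 a : P a 0 = 0 by case: (PE a).
have dP (a x : R) : a < x -> is_derive x 1 (P a) (f x) by case: (PE a) => _; exact.
have agree (a b x : R) : a < 0 -> b < 0 -> a < x -> b < x -> P a x = P b x.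
  move=> a0 b0 ax bx.
  have d0 (y : R) : Num.max a b < y -> is_derive y 1 (P a - P b) 0.
    rewrite gt_max => /andP[ay by_].
    have ? := dP a y ay; have ? := dP b y by_.
    by apply: is_derive_eq; rewrite subrr.
  suff : (P a - P b) x = (P a - P b) 0 by rewrite !fctE !P0; lra.
  have [x0|x0] := leP x 0.
    apply: derive_eq0_eq => // t /andP[xt _].
    by apply: d0; rewrite (lt_le_trans _ xt) // gt_max ax bx.
  apply/esym/derive_eq0_eq; first exact: ltW.
  by move=> t /andP[t0 _]; apply: d0; rewrite (lt_le_trans _ t0) // gt_max a0 b0.
(* The lower bound is left of both 0 and x. *)
exists (fun x => P (- `|x| - 1) x) => [|x]; first exact: P0.
have := ler_norm (- x); rewrite normrN => nx.
have := normr_ge0 x => nx0.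
apply: (@near_eq_is_derive _ _ _ (P (- `|x| - 2))); last first.
  by apply: dP; lra.
near=> y.
have yx : `|y - x| < 1.
  by near: y; apply: (@cvgr_distC_lt _ _ _ (nbhs x) _ id) => //; exact: ltr01.
have := ler_norm (- y); rewrite normrN => ny; have := normr_ge0 y => ny0.
have := lerB_dist x y; rewrite distrC => ?.
have := ler_norm (y - x) => ?; have := ler_norm (x - y); rewrite distrC => ?.
by apply: agree; lra.
Unshelve. all: by end_near. Qed.

(** * Global solutions of Lipschitz equations *)

(** The comparison behind the contraction estimate: integrating C e^(a s) gains
the factor 1/a, which makes the Picard operator of a Lipschitz field a
contraction for the distance weighted by e^(- a |t|) as soon as a exceeds the
Lipschitz constant. *)
Lemma exp_growth_le {R : realType} (P dP : R -> R) (C a t : R) : 0 < a -> 0 <= C -> 0 <= t ->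
  (forall s : R, 0 <= s <= t -> is_derive s 1 P (dP s)) ->
  (forall s, 0 <= s <= t -> dP s <= C * expR (a * s)) ->
  P t - P 0 <= C / a * expR (a * t).
Proof.
move=> a0 C0 t0 dPE dPle.
have := @derive_nonincreasing R (fun s => P s - C / a * expR (a * s))
  (fun s => dP s - C * expR (a * s)) 0 t t0.
rewrite mulr0 expR0 mulr1 => H.
suff : P t - C / a * expR (a * t) <= P 0 - C / a.
  by have := divr_ge0 C0 (ltW a0); lra.
apply: H => s st; last by rewrite subr_le0 dPle.
have ? := dPE s st.
apply: is_derive_eq; rewrite -[_ *: _]/(_ * _) -![_ *: _]/(_ * _).
by field; rewrite gt_eqF.
Qed.

Lemma is_derive_comp_opp {R : realType} (P : R -> R) (t l : R) :
  is_derive (- t) 1 P l -> is_derive t 1 (fun s => P (- s)) (- l).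
Proof.
move=> d; have := @is_derive1_comp _ P -%R t l (-1) d _.
by rewrite mulrN1; exact.
Qed.

Lemma exp_growth_norm_le {R : realType} (P dP : R -> R) (C a t : R) : 0 < a -> 0 <= C ->
  P 0 = 0 -> (forall s : R, is_derive s 1 P (dP s)) ->
  (forall s, `|dP s| <= C * expR (a * `|s|)) -> `|P t| <= C / a * expR (a * `|t|).
Proof.
move=> a0 C0 P0 dPE dPle.
have key (Q dQ : R -> R) s : Q 0 = 0 -> (forall s : R, is_derive s 1 Q (dQ s)) ->
  (forall s, `|dQ s| <= C * expR (a * `|s|)) -> 0 <= s ->
  `|Q s| <= C / a * expR (a * s).
  move=> Q0 dQE dQle s0; rewrite ler_norml -lerNl.
  apply/andP; split.
    have := @exp_growth_le R (fun r => - Q r) (fun r => - dQ r) C a s a0 C0 s0.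
    rewrite Q0 oppr0 subr0; apply => r /andP[r0 _].
    have := dQle r; rewrite (ger0_norm r0); apply: le_trans.
    by rewrite -normrN ler_norm.
  have := @exp_growth_le R Q dQ C a s a0 C0 s0.
  rewrite Q0 subr0; apply => r /andP[r0 _].
  by have := dQle r; rewrite (ger0_norm r0); apply: le_trans; exact: ler_norm.
have [t0|t0] := leP 0 t; first by rewrite (ger0_norm t0); exact: (key P dP).
rewrite (ltr0_norm t0).
have := key (fun s => P (- s)) (fun s => - dP (- s)) (- t).
rewrite opprK oppr0; apply => // [s|s|].
- by apply: is_derive_comp_opp; exact: dPE.
- by rewrite normrN; have := dPle (- s); rewrite normrN.
- by rewrite oppr_ge0 ltW.
Qed.

Lemma exp_growth_plane_le {R : realType} (V dV : R -> R * R) (C a t : R) : 0 < a -> 0 <= C ->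
  V 0 = 0 -> (forall s : R, is_derive s 1 V (dV s)) ->
  (forall s, `|dV s| <= C * expR (a * `|s|)) -> `|V t| <= C / a * expR (a * `|t|).
Proof.
move=> a0 C0 V0 dVE dVle.
rewrite prod_normE ge_max; apply/andP; split.
- apply: (@exp_growth_norm_le R (fun s => (V s).1) (fun s => (dV s).1)) => //= [|s|s].
  + by rewrite V0.
  + by have /is_derive_pairE[] := dVE s.
  + by apply: le_trans (dVle s); rewrite prod_normE le_max lexx.
- apply: (@exp_growth_norm_le R (fun s => (V s).2) (fun s => (dV s).2)) => //= [|s|s].
  + by rewrite V0.
  + by have /is_derive_pairE[] := dVE s.
  + by apply: le_trans (dVle s); rewrite prod_normE le_max lexx orbT.
Qed.

(** The sequences a_k -+ 2 E 2^-k are monotone and enclose the limit, which is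
taken to be the supremum of the lower one. *)
Lemma geometric_cvg {R : realType} (a : nat -> R) (E : R) : 0 <= E ->
  (forall k, `|a k.+1 - a k| <= E * 2^-1 ^+ k) ->
  exists l, forall k, `|l - a k| <= 2 * E * 2^-1 ^+ k.
Proof.
move=> E0 aE.
pose lo k := a k - 2 * E * 2^-1 ^+ k; pose hi k := a k + 2 * E * 2^-1 ^+ k.
have lo_incr : {homo lo : j k / (j <= k)%N >-> j <= k}.
  apply: homo_leq => // [|k]; first exact: le_trans.
  by have := aE k; rewrite ler_norml /lo exprS => /andP[? ?]; lra.
have hi_decr : {homo hi : j k / (j <= k)%N >-> k <= j}.
  apply: homo_leq => // [x y z yx zy|k]; first exact: le_trans zy yx.
  by have := aE k; rewrite ler_norml /hi exprS => /andP[? ?]; lra.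
have lohi j k : lo j <= hi k.
  apply: le_trans (lo_incr _ _ (leq_maxl j k)) _.
  apply: le_trans (hi_decr _ _ (leq_maxr j k)).
  have : 0 <= 2^-1 ^+ maxn j k :> R by rewrite exprn_ge0 // invr_ge0.
  by move/(mulr_ge0 E0); rewrite /lo /hi; lra.
have ubS k : ubound (range lo) (hi k) by move=> _ [j _ <-].
exists (sup (range lo)) => k.
rewrite ler_norml; apply/andP; split.
  have : lo k <= sup (range lo).
    by apply: ub_le_sup; [exists (hi 0%N); exact: ubS|exists k].
  by rewrite /lo; lra.
have : sup (range lo) <= hi k by apply: ge_sup; [exists (lo 0%N); exists 0%N|exact: ubS].
by rewrite /hi; lra.
Qed.

Lemma lipschitz_continuous {R : realType} {V W : normedModType R} (G : V -> W) (L : R) :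
  (forall p q, `|G p - G q| <= L * `|p - q|) -> continuous G.
Proof.
move=> GL p; apply/cvgrPdist_lt => e e0.
near=> q.
apply: le_lt_trans (GL p q) _.
apply: (@le_lt_trans _ _ ((`|L| + 1) * `|p - q|)).
  by rewrite ler_wpM2r // (le_trans (ler_norm L)) // lerDl.
rewrite -ltr_pdivlMl; last by rewrite ltr_wpDl.
near: q; apply: (@cvgr_dist_lt _ _ _ (nbhs p) _ id); first exact: cvg_id.
by rewrite mulr_gt0 // invr_gt0 ltr_wpDl.
Unshelve. all: by end_near. Qed.

Lemma vanishing_geometric {R : realType} (x E : R) :
  (forall k : nat, x <= E * 2^-1 ^+ k) -> x <= 0.
Proof.
move=> xE.
have h : geometric E (2^-1 : R) k @[k --> \oo] --> (0 : R).
  by apply: cvg_geometric; rewrite ger0_norm ?invr_ge0 //; lra.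
rewrite -(cvg_lim _ h) //; apply: limr_ge; first by apply/cvg_ex; exists 0.
by near=> k; exact: xE.
Unshelve. all: by end_near. Qed.

(** Picard iteration with the weighted distance sup |u - v| e^(- 2 K |t|), for
which the Picard operator halves distances on the whole line. *)
Lemma lipschitz_global_solution {R : realType} (G : R * R -> R * R) (L : R) (p0 : R * R) :
  (forall p q, `|G p - G q| <= L * `|p - q|) ->
  exists2 u : R -> R * R, u 0 = p0 & forall t : R, is_derive t 1 u (G (u t)).
Proof.
move=> GL0; pose K := Num.max L 1; pose a := 2 * K.
have K1 : 1 <= K by rewrite le_max lexx orbT.
have a0 : 0 < a by rewrite /a; lra.
have GL p q : `|G p - G q| <= K * `|p - q|.
  by apply: le_trans (GL0 p q) _; rewrite ler_wpM2r // le_max lexx.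
have cG := lipschitz_continuous _ _ GL.
have /choice[I IE] : forall f : R -> R * R, exists P : R -> R * R,
    continuous f -> P 0 = 0 /\ forall t : R, is_derive t 1 P (f t).
  move=> f; have [cf|] := pselect (continuous f); last by exists f.
  have [|P1 P10 dP1] := @primitive_exists R (fun t => (f t).1).
    by move=> t; apply: (cvg_comp _ _ (cf t)); exact: cvg_fst.
  have [|P2 P20 dP2] := @primitive_exists R (fun t => (f t).2).
    by move=> t; apply: (cvg_comp _ _ (cf t)); exact: cvg_snd.
  exists (fun t => (P1 t, P2 t)) => _; rewrite P10 P20; split=> // t.
  by apply/is_derive_pairE; split; [exact: dP1|exact: dP2].
have I0 f : continuous f -> I f 0 = 0 by move=> /IE[].
have dI f (t : R) : continuous f -> is_derive t 1 (I f) (f t) by move=> /IE[].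
pose T (u : R -> R * R) t := p0 + I (G \o u) t.
have cGu (u : R -> R * R) : continuous u -> continuous (G \o u).
  by move=> cu t; apply: continuous_comp; [exact: cu|exact: cG].
have dT u (t : R) : continuous u -> is_derive t 1 (T u) (G (u t)).
  move=> cu; have ? := dI _ t (cGu u cu).
  rewrite -[G (u t)]add0r.
  exact: (@is_deriveD _ _ _ (cst p0) (I (G \o u)) t 1 0 (G (u t))).
have cT u : continuous u -> continuous (T u).
  by move=> cu t; have := dT u t cu; exact: is_derive_continuous.
have T0 u : continuous u -> T u 0 = p0.
  by move=> cu; rewrite /T I0 ?addr0 //; exact: cGu.
have contraction u v C : 0 <= C -> continuous u -> continuous v ->
    (forall t, `|u t - v t| <= C * expR (a * `|t|)) ->
    forall t, `|T u t - T v t| <= C / 2 * expR (a * `|t|).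
  move=> C0 cu cv uv t.
  (* The weight 2 K is twice the Lipschitz constant, whence the factor 1/2. *)
  have -> : C / 2 = K * C / a by rewrite /a; field; lra.
  apply: (@exp_growth_plane_le R (fun t => T u t - T v t) (fun t => G (u t) - G (v t)))=> //.
  - by rewrite mulr_ge0 //; lra.
  - by rewrite !T0 // subrr.
  - move=> s; have ? := dT u s cu; have ? := dT v s cv.
    exact: (@is_deriveB _ _ _ (T u) (T v) s 1).
  - move=> s; apply: le_trans (GL _ _) _; rewrite -mulrA ler_wpM2l ?uv //; lra.
pose U k := iter k T (cst p0).
have cU k : continuous (U k).
  by elim: k => [|k IH]; [move=> ?; exact: cvg_cst|exact: cT].
pose M := `|G p0| / a.
have M0 : 0 <= M by rewrite divr_ge0 // ltW.
have Ustep k t : `|U k.+1 t - U k t| <= M * expR (a * `|t|) * 2^-1 ^+ k.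
  rewrite mulrAC; elim: k t => [|k IH] t.
    rewrite expr0 mulr1.
    apply: (@exp_growth_plane_le R (fun t => T (cst p0) t - p0) (fun t => G p0))=> //.
    - by rewrite T0 ?subrr //; exact: (cU 0%N).
    - move=> s; have ? := dT (cst p0) s (cU 0%N); rewrite -[G p0]subr0.
      exact: (@is_deriveB _ _ _ (T (cst p0)) (cst p0) s 1).
    - move=> s; rewrite ler_peMr // -expR0 ler_expR mulr_ge0 //; exact: ltW.
  rewrite exprSr mulrA.
  apply: (contraction (U k.+1) (U k)) => //.
  by rewrite mulr_ge0 // exprn_ge0 // invr_ge0.
have /choice[u uE] : forall t : R, exists l : R * R, forall k,
    `|l - U k t| <= 2 * M * expR (a * `|t|) * 2^-1 ^+ k.
  move=> t.
  have [||l1 l1E] := @geometric_cvg R (fun k => (U k t).1) (M * expR (a * `|t|)).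
  - by rewrite mulr_ge0 // expR_ge0.
  - by move=> k; apply: le_trans (Ustep k t); rewrite prod_normE le_max lexx.
  have [||l2 l2E] := @geometric_cvg R (fun k => (U k t).2) (M * expR (a * `|t|)).
  - by rewrite mulr_ge0 // expR_ge0.
  - by move=> k; apply: le_trans (Ustep k t); rewrite prod_normE le_max lexx orbT.
  exists (l1, l2) => k; rewrite prod_normE ge_max /=; move: (l1E k) (l2E k).
  by rewrite !mulrA => -> ->.
have cu : continuous u.
  move=> t; apply/cvgrPdist_lt => e e0.
  pose E := 2 * M * expR (a * (`|t| + 1)).
  have E0 : 0 <= E by rewrite /E mulr_ge0 // mulr_ge0.
  have [k kE] : exists k, E * 2^-1 ^+ k < e / 3.
    apply/not_existsP => nk.
    have : e / 3 <= 0.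
      by apply: (@vanishing_geometric _ _ E) => k; rewrite leNgt; apply/negP/nk.
    by lra.
  near=> s.
  have ts : `|s| <= `|t| + 1.
    have : `|t - s| < 1.
      near: s; apply: (@cvgr_dist_lt _ _ _ (nbhs t) _ id) => //; exact: ltr01.
    by have := lerB_dist s t; rewrite distrC; lra.
  have bd r : `|r| <= `|t| + 1 -> `|u r - U k r| < e / 3.
    move=> rt; apply: le_lt_trans (uE r k) (le_lt_trans _ kE).
    rewrite ler_wpM2r ?exprn_ge0 ?invr_ge0 //.
    rewrite /E ler_wpM2l //; first by rewrite mulr_ge0.
    by rewrite ler_expR ler_wpM2l // ltW.
  have Uts : `|U k t - U k s| < e / 3.
    near: s; apply: (@cvgr_dist_lt _ _ _ (nbhs t) _ (U k)); last by rewrite divr_gt0.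
    exact: cU.
  have -> : u t - u s = (u t - U k t) + (U k t - U k s) - (u s - U k s).
    by rewrite opprB !addrA subrK addrNK.
  have := bd t; have := bd s ts; rewrite lerDl ler01 => h1 /(_ isT) h2.
  apply: le_lt_trans (ler_normB _ _) _.
  by have := ler_normD (u t - U k t) (U k t - U k s); lra.
have uT t : T u t = u t.
  apply/eqP; rewrite -subr_eq0 -normr_le0.
  apply: (@vanishing_geometric _ _ (2 * M * expR (a * `|t|))) => k.
  have h1 := uE t k.+1.
  have h2 : `|T u t - U k.+1 t| <= M * expR (a * `|t|) * 2^-1 ^+ k.
    have -> : M * expR (a * `|t|) * 2^-1 ^+ k =
      (2 * M * 2^-1 ^+ k) / 2 * expR (a * `|t|) by field.
    apply: (contraction u (U k)) => //; first by rewrite mulr_ge0 ?(mulr_ge0 _ M0) // exprn_ge0 // invr_ge0.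
    by move=> s; rewrite mulrAC; exact: uE.
  have -> : T u t - u t = (T u t - U k.+1 t) - (u t - U k.+1 t).
    by rewrite opprB addrA subrK.
  apply: le_trans (ler_normB _ _) _.
  by move: h1; rewrite exprS; lra.
exists u; first by rewrite -uT T0.
by move=> t; rewrite -[X in is_derive _ _ X](funext uT); exact: dT.
Unshelve. all: by end_near. Qed.

(** * Gronwall estimates, uniqueness and maximal solutions *)

(** Multiply D by e^(-+ k (s - t0)) to get a monotone function on either side
of t0. *)
Lemma gronwall {R : realType} (I : set R) (D dD : R -> R) (k t0 t : R) :
  is_interval I -> (forall s : R, I s -> is_derive s 1 D (dD s)) ->
  (forall s, I s -> `|dD s| <= k * D s) -> I t0 -> I t ->
  D t <= D t0 * expR (k * `|t - t0|).
Proof.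
move=> itvI dDE dDle It0 It.
have [t0t|tt0] := leP t0 t.
  have Is s : t0 <= s <= t -> I s by exact: itvI.
  rewrite ger0_norm ?subr_ge0 //.
  have := @derive_nonincreasing R (fun s => D s * expR (- k * (s - t0)))
    (fun s => (dD s - k * D s) * expR (- k * (s - t0))) t0 t t0t.
  rewrite subrr mulr0 expR0 mulr1 => H.
  rewrite -(@ler_pM2r _ (expR (- k * (t - t0)))) ?expR_gt0 //.
  rewrite -mulrA -expRD -mulrDl subrr mul0r expR0 mulr1.
  apply: H => s st; last first.
    rewrite mulr_le0_ge0 ?expR_ge0 // subr_le0.
    by apply: le_trans (dDle s (Is s st)); exact: ler_norm.
  have ? := dDE s (Is s st).
  apply: is_derive_eq; rewrite -![_ *: _]/(_ * _); ring.
have Is s : t <= s <= t0 -> I s by exact: itvI.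
rewrite ltr0_norm ?subr_lt0 //.
have := @derive_nondecreasing R (fun s => D s * expR (k * (s - t0)))
  (fun s => (dD s + k * D s) * expR (k * (s - t0))) t t0 (ltW tt0).
rewrite subrr mulr0 expR0 mulr1 => H.
rewrite -(@ler_pM2r _ (expR (k * (t - t0)))) ?expR_gt0 //.
rewrite -mulrA -expRD -mulrDr addNr mulr0 expR0 mulr1.
apply: H => s st; last first.
  rewrite mulr_ge0 ?expR_ge0 //.
  by have := dDle s (Is s st); rewrite ler_norml => /andP[? _]; lra.
have ? := dDE s (Is s st).
apply: is_derive_eq; rewrite -![_ *: _]/(_ * _); ring.
Qed.

Lemma prod_norm_fst {R : realType} (p : R * R) : `|p.1| <= `|p|.
Proof. by rewrite prod_normE le_max lexx. Qed.

Lemma prod_norm_snd {R : realType} (p : R * R) : `|p.2| <= `|p|.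
Proof. by rewrite prod_normE le_max lexx orbT. Qed.

Lemma prod_norm_le {R : realType} (p : R * R) (B : R) :
  (`|p| <= B) = (`|p.1| <= B) && (`|p.2| <= B).
Proof. by rewrite prod_normE ge_max. Qed.

Lemma prod_norm_sqr_le {R : realType} (p : R * R) : `|p| ^+ 2 <= p.1 ^+ 2 + p.2 ^+ 2.
Proof.
rewrite prod_normE /Num.max; have := sqr_ge0 p.1; have := sqr_ge0 p.2.
by case: ifP => _; rewrite real_normK ?num_real //; lra.
Qed.

Lemma prod_norm_sqr_ge {R : realType} (p : R * R) : p.1 ^+ 2 + p.2 ^+ 2 <= 2 * `|p| ^+ 2.
Proof.
have h1 : p.1 ^+ 2 <= `|p| ^+ 2 
    by rewrite -(real_normK (num_real p.1)) lerXn2r ?nnegrE ?prod_norm_fst.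
have h2 : p.2 ^+ 2 <= `|p| ^+ 2 
    by rewrite -(real_normK (num_real p.2)) lerXn2r ?nnegrE ?prod_norm_snd.
lra.
Qed.

(** The maximum norm is not differentiable, so the estimate goes through the sum
of the squares of the coordinates; this costs the factors 2 and 4. *)
Lemma gronwall_plane {R : realType} (I : set R) (w dw : R -> R * R) (k t0 t : R) :
  is_interval I -> (forall s : R, I s -> is_derive s 1 w (dw s)) ->
  (forall s, I s -> `|dw s| <= k * `|w s|) -> 0 <= k -> I t0 -> I t ->
  `|w t| ^+ 2 <= 2 * `|w t0| ^+ 2 * expR (4 * k * `|t - t0|).
Proof.
move=> itvI dwE dwle k0 It0 It.
apply: le_trans (prod_norm_sqr_le _) _.
apply: (@le_trans _ _ (((w t0).1 ^+ 2 + (w t0).2 ^+ 2) * expR (4 * k * `|t - t0|))); last first.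
  by rewrite ler_wpM2r ?expR_ge0 // prod_norm_sqr_ge.
apply: (@gronwall R I (fun s => (w s).1 ^+ 2 + (w s).2 ^+ 2)
   (fun s => 2 * ((w s).1 * (dw s).1 + (w s).2 * (dw s).2)) (4 * k)) => // s Is.
  have /is_derive_pairE[? ?] := dwE s Is.
  apply: is_derive_eq; rewrite -![_ *: _]/(_ * _) /= !mulr_natl; ring.
have le1 (x dx : R) : `|x| <= `|w s| -> `|dx| <= `|dw s| -> `|x * dx| <= k * `|w s| ^+ 2.
  move=> xw dxw; rewrite normrM expr2 mulrA mulrC ler_pM //.
  exact: le_trans (dwle s Is).
rewrite normrM ger0_norm //.
have := le1 _ _ (prod_norm_fst (w s)) (prod_norm_fst (dw s)).
have := le1 _ _ (prod_norm_snd (w s)) (prod_norm_snd (dw s)).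
have := ler_normD ((w s).1 * (dw s).1) ((w s).2 * (dw s).2).
have := ler_wpM2l k0 (prod_norm_sqr_le (w s)).
lra.
Qed.

Lemma gronwall_plane_eq0 {R : realType} (I : set R) (w dw : R -> R * R) (k t0 t : R) :
  is_interval I -> (forall s : R, I s -> is_derive s 1 w (dw s)) ->
  (forall s, I s -> `|dw s| <= k * `|w s|) -> 0 <= k -> I t0 -> I t ->
  w t0 = 0 -> w t = 0.
Proof.
move=> itvI dwE dwle k0 It0 It w0.
have := gronwall_plane _ _ _ _ _ _ itvI dwE dwle k0 It0 It.
rewrite w0 normr0 expr0n mulr0 mul0r => h; apply/eqP; rewrite -normr_le0.
by move: h; rewrite real_exprn_even_le0 // ?num_real //= => /eqP ->.
Qed.

(** Bounded sets are described by balls, so this is Lipschitz continuity on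
bounded sets, which in the plane is the same as local Lipschitz continuity. *)
Definition locally_lipschitz {R : realType} {W : normedModType R} (F : R * R -> W) :=
  forall B : R, exists2 L, 0 <= L & forall p q, `|p| <= B -> `|q| <= B ->
    `|F p - F q| <= L * `|p - q|.

Lemma continuous_segment_bounded {R : realType} (u : R -> R * R) (a b : R) : a <= b ->
  (forall s : R, a <= s <= b -> {for s, continuous u}) ->
  exists B, forall s, a <= s <= b -> `|u s| <= B.
Proof.
move=> ab cu.
have [|c _ cE] := @EVT_max R (fun s => `|u s|) a b ab; last first.
  by exists `|u c| => s sab; apply: cE; rewrite in_itv.
apply: continuous_in_subspaceT => s; rewrite inE /= in_itv /= => sab.
by apply: cvg_norm; exact: cu.
Qed.

Lemma solution_segment_unique {R : realType} (F : R * R -> R * R) (u v : R -> R * R) (a b t0 t : R) :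
  locally_lipschitz F -> a <= b ->
  (forall s : R, a <= s <= b -> is_derive s 1 u (F (u s))) ->
  (forall s : R, a <= s <= b -> is_derive s 1 v (F (v s))) ->
  a <= t0 <= b -> a <= t <= b -> u t0 = v t0 -> u t = v t.
Proof.
move=> FL ab du dv t0ab tab uv.
have [|B uB] := @continuous_segment_bounded R u a b ab.
  by move=> s sab; have := du s sab; exact: is_derive_continuous.
have [|B' vB] := @continuous_segment_bounded R v a b ab.
  by move=> s sab; have := dv s sab; exact: is_derive_continuous.
have [L L0 LE] := FL (Num.max B B').
apply/eqP; rewrite -subr_eq0; apply/eqP.
apply: (@gronwall_plane_eq0 R [set s | a <= s <= b] (fun s => u s - v s)
  (fun s => F (u s) - F (v s)) L t0) => //=.
- move=> x y /= /andP[ax _] /andP[_ yb] z /andP[xz zy].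
  by rewrite (le_trans ax xz) (le_trans zy yb).
- move=> s sab; have ? := du s sab; have ? := dv s sab.
  exact: (@is_deriveB _ _ _ u v s 1).
- by move=> s sab; apply: LE; rewrite le_max ?uB ?vB ?orbT.
- by rewrite uv subrr.
Qed.

Lemma solution_unique {R : realType} (F : R * R -> R * R) (I J : set R) (u v : R -> R * R) (t0 t : R) :
  locally_lipschitz F -> solution F I u -> solution F J v ->
  I t0 -> J t0 -> u t0 = v t0 -> I t -> J t -> u t = v t.
Proof.
move=> FL [_ itvI du] [_ itvJ dv] It0 Jt0 uv It Jt.
have sub s : Num.min t0 t <= s <= Num.max t0 t -> I s /\ J s.
  move=> st; split; [apply: (itvI (Num.min t0 t) (Num.max t0 t) _ _ s st)|apply: (itvJ (Num.min t0 t) (Num.max t0 t) _ _ s st)];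
    by case: (leP t0 t) => _.
apply: (@solution_segment_unique R F u v (Num.min t0 t) (Num.max t0 t) t0) => //.
- by rewrite ge_min le_max lexx.
- by move=> s /sub[/du].
- by move=> s /sub[_ /dv].
- by rewrite ge_min le_max lexx.
- by rewrite ge_min le_max lexx !orbT.
Qed.

(** By uniqueness all the solutions with the same value at t0 can be glued
together. *)
Lemma greatest_solution {R : realType} (F : R * R -> R * R) (I : set R) (u : R -> R * R) (t0 : R) :
  locally_lipschitz F -> solution F I u -> I t0 ->
  exists J v, [/\ solution F J v, J t0 & forall K w, solution F K w -> K t0 -> w t0 = u t0 ->
    K `<=` J /\ forall t, K t -> v t = w t].
Proof.
move=> FL solu It0.
pose Fam (K : set R) w := [/\ solution F K w, K t0 & w t0 = u t0].
pose J t := exists K w, Fam K w /\ K t.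
have /choice[v vE] : forall t, exists y, forall K w, Fam K w -> K t -> w t = y.
  move=> t; have [[K [w [[solw Kt0 w0] Kt]]]|nJ] := pselect (J t); last first.
    by exists 0 => K w Kw Kt; case: nJ; exists K, w.
  exists (w t) => K' w' [solw' K't0 w'0] K't.
  apply: (solution_unique F K' K w' w t0 t FL solw' solw) => //.
  by rewrite w'0 w0.
exists J, v; split; first split.
- rewrite openE => t [K [w [Kw Kt]]].
  have [[oK _ _] _ _] := Kw.
  rewrite openE in oK; apply: filterS (oK t Kt) => s Ks.
  by exists K, w.
- have J1 s x : J x -> Num.min t0 x <= s <= Num.max t0 x -> J s.
    move=> [K [w [Kw Kx]]] sx; exists K, w; split=> //.
    have [[_ itvK _] Kt0 _] := Kw.
    by apply: (itvK (Num.min t0 x) (Num.max t0 x) _ _ s sx); case: (leP t0 x) => _.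
  move=> x y Jx Jy z /andP[xz zy].
  have [zt0|t0z] := leP z t0.
    by apply: (J1 z x) => //; rewrite ge_min le_max xz zt0 orbT.
  by apply: (J1 z y) => //; rewrite ge_min le_max zy (ltW t0z) orbT.
- move=> t [K [w [Kw Kt]]].
  have [[oK _ dw] _ _] := Kw.
  apply: (@near_eq_is_derive _ _ _ w).
    rewrite openE in oK; apply: filterS (oK t Kt) => s Ks.
    exact: vE Kw Ks.
  by rewrite -(vE t K w) //; exact: dw.
- by exists I, u.
- move=> K w solw Kt0 w0; split=> [t Kt|t Kt]; first by exists K, w.
  by apply/esym/(vE t K w).
Qed.

Lemma trajectory_extension {R : realType} (F : R * R -> R * R) (I : set R) (u : R -> R * R) :
  locally_lipschitz F -> solution F I u -> I !=set0 ->
  exists J v, [/\ trajectory F J v, I `<=` J & forall t, I t -> v t = u t].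
Proof.
move=> FL solu [t0 It0].
have [J [v [solv Jt0 vmax]]] := greatest_solution _ _ _ _ FL solu It0.
have [IJ vu] := vmax _ _ solu It0 erefl.
exists J, v; split=> //; split => //; first by exists t0.
move=> K w solw JK wv.
have [|KJ _] := vmax K w solw (JK _ Jt0); last exact: KJ.
by rewrite wv // vu.
Qed.

(** A trajectory is maximal, so it is the greatest solution with its value at t0,
and contains every other solution with that value. *)
Lemma trajectory_contains {R : realType} (F : R * R -> R * R) (I J : set R) (u v : R -> R * R) (t0 : R) :
  locally_lipschitz F -> trajectory F I u -> solution F J v -> I t0 -> J t0 ->
  u t0 = v t0 -> J `<=` I /\ forall t, J t -> u t = v t.
Proof.
move=> FL [_ solu umax] solv It0 Jt0 uv.
have [K [w [solw Kt0 wmax]]] := greatest_solution _ _ _ _ FL solu It0.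
have [IK wu] := wmax _ _ solu It0 erefl.
have [JK wv] := wmax _ _ solv Jt0 (esym uv).
have KI := umax K w solw IK wu.
split=> [t Jt|t Jt]; first exact/KI/JK.
by rewrite -wv // wu //; exact/KI/JK.
Qed.

(** Invariance tested on all solutions rather than on the maximal ones only; this
form can be used on short time intervals. *)
Definition solution_invariant {R : realType} (F : R * R -> R * R) (C : set (R * R)) :=
  forall I u, solution F I u -> forall s t, I s -> I t -> C (u s) -> C (u t).

Lemma flow_invariantE {R : realType} (F : R * R -> R * R) (C : set (R * R)) :
  locally_lipschitz F -> flow_invariant F C <-> solution_invariant F C.
Proof.
move=> FL; split => [inv I u solu s t Is It Cs|inv I u [_ solu _] s t].
  have [|J [v [trajv IJ vu]]] := trajectory_extension _ _ _ FL solu; first by exists s.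
  have := inv J v trajv s t (IJ _ Is) (IJ _ It).
  by rewrite !vu //; exact.
exact: inv solu s t.
Qed.

(** * Solutions inside a compact invariant set *)

(** The nearest point of the square of side 2 B (for B >= 0); composing a field
with it makes the field globally Lipschitz and does not change it on the
square. *)
Definition clamp {R : realType} (B : R) (p : R * R) : R * R :=
  (Num.max (- B) (Num.min B p.1), Num.max (- B) (Num.min B p.2)).

Lemma clamp_bounded {R : realType} (B : R) (p : R * R) : 0 <= B -> `|clamp B p| <= B.
Proof.
move=> B0; rewrite prod_norm_le /= !ler_norml !le_max !ge_max !ge_min lexx /= lexx /=.
by rewrite ?andbT ?orTb; lra.
Qed.

Lemma clamp_id {R : realType} (B : R) (p : R * R) : `|p| <= B -> clamp B p = p.
Proof.
rewrite prod_norm_le !ler_norml => /andP[/andP[a b] /andP[c d]].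
by case: p a b c d => x y /= a b c d; rewrite /clamp /= !min_r // !max_r.
Qed.

Lemma clamp_lipschitz {R : realType} (B : R) (p q : R * R) : 0 <= B ->
  `|clamp B p - clamp B q| <= `|p - q|.
Proof.
move=> B0.
have maxL (a x y : R) : `|Num.max a x - Num.max a y| <= `|x - y|.
  have := ler_norm (x - y); have := ler_norm (y - x); rewrite (distrC y x).
  by rewrite ler_norml; case: (leP a x); case: (leP a y); lra.
have minL (a x y : R) : `|Num.min a x - Num.min a y| <= `|x - y|.
  have := ler_norm (x - y); have := ler_norm (y - x); rewrite (distrC y x).
  by rewrite ler_norml; case: (leP a x); case: (leP a y); lra.
have key (x y : R) : `|Num.max (- B) (Num.min B x) - Num.max (- B) (Num.min B y)| <= `|x - y|.
  exact: le_trans (maxL _ _ _) (minL _ _ _).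
rewrite prod_norm_le.
by rewrite (le_trans (key _ _) (prod_norm_fst (p - q))) (le_trans (key _ _) (prod_norm_snd (p - q))).
Qed.

Lemma truncated_solution {R : realType} (F : R * R -> R * R) (B : R) (p : R * R) :
  locally_lipschitz F -> 0 <= B ->
  exists2 v : R -> R * R, v 0 = p & forall t : R, is_derive t 1 v (F (clamp B (v t))).
Proof.
move=> FL B0; have [L L0 LE] := FL B.
apply: (@lipschitz_global_solution R (F \o clamp B) L p) => x y /=.
apply: le_trans (LE _ _ (clamp_bounded _ _ B0) (clamp_bounded _ _ B0)) _.
by rewrite ler_wpM2l // clamp_lipschitz.
Qed.

Lemma ball_interval {R : realType} (x e : R) : is_interval (ball x e).
Proof.
move=> a b; rewrite /ball /= => xa xb z /andP[az zb].
by move: xa xb; rewrite !ltr_norml; lra.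
Qed.

(** Take the global solution v of the field truncated outside a larger square.
The times at which v is in C form a closed set, and an open one because near
such a time v solves the original equation and C is invariant. *)
Lemma compact_invariant_complete {R : realType} (F : R * R -> R * R) (C : set (R * R)) (p : R * R) (B : R) :
  locally_lipschitz F -> closed C -> (forall q, C q -> `|q| <= B) ->
  solution_invariant F C -> C p ->
  exists v : R -> R * R, [/\ v 0 = p, forall t : R, is_derive t 1 v (F (v t)) & forall t, C (v t)].
Proof.
move=> FL clC CB inv Cp.
have B0 : 0 <= B + 1 by have := CB _ Cp; have := normr_ge0 p; lra.
have [v v0 dv] := truncated_solution F (B + 1) p FL B0.
have cv : continuous v by move=> t; have := dv t; exact: is_derive_continuous.
suff vC t : C (v t).
  exists v; split => // t; have := dv t; rewrite clamp_id //.
  by have := CB _ (vC t); lra.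
have : [set t | C (v t)] = setT.
  have /connected_intervalP cT : is_interval [set: R] by [].
  apply: cT; first by exists 0 => /=; rewrite v0.
    exists [set t | C (v t)]; last by rewrite setTI.
    rewrite openE => s /= Cs.
    have /nbhs_normP[e /= e0 eE] : \forall r \near s, `|v r| < B + 1.
      apply: (@cvgr_norm_lt _ _ _ (nbhs s) _ v (v s) (cv s)).
      by have := CB _ Cs; lra.
    rewrite ball_normE in eE.
    apply/nbhs_normP; exists e => //= r; rewrite ball_normE => er.
    apply: (inv (ball s e) v _ s r) => //; last exact: ballxx.
    split; first exact: ball_open.
      exact: ball_interval.
    by move=> x xe; have := dv x; rewrite clamp_id // ltW // eE.
  exists [set t | C (v t)]; last by rewrite setTI.
  by apply: closed_comp => // ? _; exact: cv.
by move=> E; have : [set: R] t by []; rewrite -E.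
Qed.

(** * The scaling symmetry and compact invariant sets *)

Definition star_field {R : realType} (lam : R) (q : R * R -> R * R) (p : R * R) : R * R :=
  lam *: p + q p.

(** Multiplication by nonnegative factors is what moves points along the rays. *)
Definition positively_homogeneous {R : realType} (n : nat) (q : R * R -> R * R) :=
  forall (c : R) p, 0 <= c -> q (c *: p) = c ^+ n *: q p.

(** This is e^(mu s), where s is the time at which the reference solution has to
be read to obtain at time t the solution that starts k^(1/m) times further
out. *)
Definition ray_clock {R : realType} (mu k t : R) : R := 1 + k * (expR (mu * t) - 1).

Lemma ray_clock_itv {R : realType} (mu k : R) : 0 < mu -> 0 < k ->
  open [set t | 0 < ray_clock mu k t] /\ is_interval [set t | 0 < ray_clock mu k t].
Proof.
move=> mu0 k0; split.
  apply: (@open_comp _ _ (ray_clock mu k) [set x | 0 < x]); last exact: open_gt.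
  move=> t _.
  apply: (@is_derive_continuous _ _ _ _ (k * (mu * expR (mu * t)))).
  by apply: is_derive_eq; rewrite -![_ *: _]/(_ * _); ring.
move=> x y /= x0 _ z /andP[xz _].
apply: lt_le_trans x0 _; rewrite /ray_clock lerD2l ler_wpM2l ?(ltW k0) //.
by rewrite lerD2r ler_expR ler_wpM2l // ltW.
Qed.

(** The image of u under the scaling symmetry; it starts at kap u(0). *)
Definition rescaled {R : realType} (lam : R) (m : nat) (kap : R) (u : R -> R * R) (t : R) : R * R :=
  let s := ln (ray_clock (m%:R * lam) (kap ^+ m) t) / (m%:R * lam) in
  (kap * expR (lam * (t - s))) *: u s.

Section StarField.
Context {R : realType} (lam : R) (m : nat) (q : R * R -> R * R).
Hypothesis lam_gt0 : 0 < lam.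
Hypothesis m_gt0 : (0 < m)%N.
Hypothesis q_hom : positively_homogeneous m.+1 q.
Hypothesis q_lip : locally_lipschitz q.

Let F := star_field lam q.
Let mu : R := m%:R * lam.

Let mu_gt0 : 0 < mu. Proof. by rewrite mulr_gt0 // ltr0n. Qed.

Lemma star_field_lipschitz : locally_lipschitz F.
Proof.
move=> B; have [L L0 LE] := q_lip B.
exists (lam + L); first by rewrite addr_ge0 // ltW.
move=> x y xB yB; rewrite /F /star_field opprD addrACA -scalerBr mulrDl.
apply: le_trans (ler_normD _ _) _.
by rewrite normrZ gtr0_norm // lerD2l LE.
Qed.

(** With d = s'(t), the chain rule produces lam (1 - d) from the exponential and
d (lam u + q u) from u(s).  The terms in lam u add up to lam times the rescaled
solution, and d equals the m-th power of the scaling factor, so that the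
remaining term is q of the rescaled solution. *)
Lemma rescaled_solution (kap : R) (u : R -> R * R) (t : R) : 0 < kap ->
  (forall s : R, is_derive s 1 u (F (u s))) -> 0 < ray_clock mu (kap ^+ m) t ->
  is_derive t 1 (rescaled lam m kap u) (F (rescaled lam m kap u t)).
Proof.
move=> kap0 du den0.
set k := kap ^+ m in den0.
pose den := ray_clock mu k.
pose tt s := ln (den s) / mu.
pose d := k * expR (mu * t) / den t.
have dden : is_derive t 1 den (k * (mu * expR (mu * t))).
  by apply: is_derive_eq; rewrite -![_ *: _]/(_ * _); ring.
have dln : is_derive (den t) 1 (@ln R) (den t)^-1 by exact: is_derive1_ln.
have dtt : is_derive t 1 tt d.
  have ? : is_derive t 1 (fun s => ln (den s)) ((den t)^-1 * (k * (mu * expR (mu * t)))).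
    exact: is_derive1_comp.
  apply: is_derive_eq; rewrite -![_ *: _]/(_ * _) /d.
  by field; rewrite !gt_eqF.
have E : (kap * expR (lam * (t - tt t))) ^+ m = d.
  rewrite exprMn -expRM_natl -/k /d -mulrA; congr (_ * _).
  have -> : m%:R * (lam * (t - tt t)) = mu * t - ln (den t).
    rewrite /tt /mu; field.
    by rewrite pnatr_eq0 -lt0n m_gt0 gt_eqF.
  by rewrite expRD expRN lnK ?posrE.
have /is_derive_pairE[du1 du2] := du (tt t).
have key (f : R -> R) (l : R) : is_derive (tt t) 1 f (lam * f (tt t) + l) ->
  is_derive t 1 (fun s => kap * expR (lam * (s - tt s)) * f (tt s))
    (lam * (kap * expR (lam * (t - tt t)) * f (tt t)) + (kap * expR (lam * (t - tt t))) ^+ m.+1 * l).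
  move=> df.
  have ? : is_derive t 1 (fun s => f (tt s)) ((lam * f (tt t) + l) * d).
    exact: is_derive1_comp.
  apply: is_derive_eq; rewrite -![_ *: _]/(_ * _) exprS E; ring.
have e0 : 0 <= kap * expR (lam * (t - tt t)) by rewrite mulr_ge0 ?expR_ge0 // ltW.
have -> : F (rescaled lam m kap u t) = lam *: ((kap * expR (lam * (t - tt t))) *: u (tt t)) +
    (kap * expR (lam * (t - tt t))) ^+ m.+1 *: q (u (tt t)).
  by rewrite -(q_hom _ _ e0).
apply/is_derive_pairE; split.
  exact: (key (fun s => (u s).1) (q (u (tt t))).1 du1).
exact: (key (fun s => (u s).2) (q (u (tt t))).2 du2).
Qed.

Lemma rescaled0 (kap : R) (u : R -> R * R) : rescaled lam m kap u 0 = kap *: u 0.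
Proof.
by rewrite /rescaled /ray_clock mulr0 expR0 subrr mulr0 addr0 ln1 mul0r subrr mulr0 expR0 mulr1.
Qed.

Lemma rescaled_solves (kap : R) (u : R -> R * R) : 0 < kap ->
  (forall s : R, is_derive s 1 u (F (u s))) ->
  solution F [set t | 0 < ray_clock mu (kap ^+ m) t] (rescaled lam m kap u).
Proof.
move=> kap0 du.
have [? ?] := ray_clock_itv _ _ mu_gt0 (exprn_gt0 m kap0).
by split => // t /= t0; exact: rescaled_solution.
Qed.

Lemma ray_clock0 (k : R) : ray_clock mu k 0 = 1.
Proof. by rewrite /ray_clock mulr0 expR0 subrr mulr0 addr0. Qed.

(** If kap > 1, the equation e^(mu s) = 1 + kap^m (e^(mu t) - 1) sends s = - oo
to a finite time t.  Reading u at very negative s shows that v, which is the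
rescaled u, is arbitrarily large at times t near that one. *)
Lemma global_solutions_same_ray_le (u v : R -> R * R) (kap B del : R) :
  (forall s : R, is_derive s 1 u (F (u s))) -> (forall s : R, is_derive s 1 v (F (v s))) ->
  0 < del -> (forall s, del <= `|u s|) -> (forall s, `|v s| <= B) ->
  0 < kap -> v 0 = kap *: u 0 -> kap <= 1.
Proof.
move=> du dv del0 udel vB kap0 v0; rewrite leNgt; apply/negP => kap1.
set k := kap ^+ m.
have k1 : 1 < k by rewrite exprn_egt1 // -lt0n.
have B0 : 0 <= B by apply: le_trans (vB 0).
have dm0 : 0 < del ^+ m by rewrite exprn_gt0.
(* X is e^(- mu s) for the time s = T at which u is read; it is chosen so that
   the lower bound (k - 1) X del^m for |v t|^m exceeds B^m. *)
pose X := 1 + B ^+ m / ((k - 1) * del ^+ m).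
have X1 : 1 <= X by rewrite lerDl divr_ge0 ?exprn_ge0 // mulr_ge0 ?(ltW dm0) //; lra.
have X0 : 0 < X by lra.
pose T := - ln X / mu.
have ET : expR (mu * T) = X^-1.
  by rewrite /T mulrCA mulfV ?gt_eqF // mulr1 expRN lnK ?posrE.
pose a := 1 + k^-1 * (X^-1 - 1).
have ka : k * a = k - 1 + X^-1 by rewrite /a; field; lra.
have Xi0 : 0 < X^-1 by rewrite invr_gt0.
have a0 : 0 < a.
  by rewrite -(@pmulr_rgt0 _ k) ?ka; lra.
pose t := ln a / mu.
have Et : expR (mu * t) = a by rewrite /t mulrCA mulfV ?gt_eqF // mulr1 lnK ?posrE.
have clockt : ray_clock mu k t = X^-1 by rewrite /ray_clock Et mulrBr mulr1 ka; lra.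
have vt : v t = rescaled lam m kap u t.
  have soluk := rescaled_solves kap u kap0 du.
  apply: (@solution_unique R F setT _ v (rescaled lam m kap u) 0 t star_field_lipschitz _ soluk) => //=.
  - by split => //; exact: openT.
  - by rewrite ray_clock0.
  - by rewrite rescaled0.
  - by rewrite clockt.
have := vB t; rewrite vt /rescaled -/mu -/k clockt lnV ?posrE //.
rewrite -/T normrZ ger0_norm ?mulr_ge0 ?expR_ge0 ?(ltW kap0) // => le1.
have : (kap * expR (lam * (t - T)) * del) ^+ m <= B ^+ m.
  rewrite lerXn2r ?nnegrE ?mulr_ge0 ?expR_ge0 ?(ltW kap0) ?(ltW del0) //.
  apply: le_trans le1; rewrite ler_wpM2l ?udel // mulr_ge0 ?expR_ge0 //; exact: ltW.
rewrite !exprMn -expRM_natl -/k.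
have -> : m%:R * (lam * (t - T)) = mu * t - mu * T by rewrite /mu; ring.
rewrite expRD expRN Et ET invrK mulrA ka.
have : (k - 1) * del ^+ m * X = (k - 1) * del ^+ m + B ^+ m.
  rewrite /X; field; rewrite gt_eqF //=; lra.
have : 0 < (k - 1) * del ^+ m by rewrite mulr_gt0 //; lra.
have : 0 < X^-1 * X * del ^+ m by rewrite !mulr_gt0.
rewrite !mulrDl => ? ? ?; lra.
Qed.

(** A compact set that misses the origin, in the form in which it is used. *)
Definition punctured_compact (C : set (R * R)) :=
  [/\ closed C, exists B, forall p, C p -> `|p| <= B & ~ C 0].

Lemma punctured_away (C : set (R * R)) : punctured_compact C ->
  exists2 del : R, 0 < del & forall p, C p -> del <= `|p|.
Proof.
move=> [clC _ C0].
have : nbhs (0 : R * R) (~` C) by move: clC; rewrite -openC openE; apply.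
move=> /nbhs_normP[e /= e0 eE]; exists e => // p Cp.
rewrite leNgt; apply/negP => pe; apply: (eE p) => //=.
by rewrite sub0r normrN.
Qed.

Lemma invariant_orbit (C : set (R * R)) p : punctured_compact C -> solution_invariant F C -> C p ->
  exists v : R -> R * R, [/\ v 0 = p, forall t : R, is_derive t 1 v (F (v t)) & forall t, C (v t)].
Proof.
by move=> [clC [B CB] _] inv Cp; exact: (compact_invariant_complete F C p B star_field_lipschitz).
Qed.

(** The inequality kap <= 1 holds for the orbits of p and kap p, and also with
their roles exchanged and kap inverted. *)
Lemma invariant_meets_ray_once (C : set (R * R)) (p : R * R) (kap : R) :
  punctured_compact C -> solution_invariant F C ->
  C p -> C (kap *: p) -> 0 < kap -> kap = 1.
Proof.
move=> pcC inv Cp Ckp kap0.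
have [del del0 delE] := punctured_away C pcC.
have [B BE] : exists B, forall p, C p -> `|p| <= B by case: pcC.
have [u [u0 du Cu]] := invariant_orbit C p pcC inv Cp.
have [v [v0 dv Cv]] := invariant_orbit C _ pcC inv Ckp.
apply/eqP; rewrite eq_le; apply/andP; split.
  apply: (@global_solutions_same_ray_le u v kap B del) => // [s|s|].
  - exact/delE/Cu.
  - exact/BE/Cv.
  - by rewrite v0 u0.
rewrite -invf_le1 //.
apply: (@global_solutions_same_ray_le v u kap^-1 B del) => // [s|s||].
- exact/delE/Cv.
- exact/BE/Cu.
- by rewrite invr_gt0.
- by rewrite v0 u0 scalerA mulVf ?scale1r // gt_eqF.
Qed.
End StarField.

(** * Invariant rays *)

Definition cross {R : realType} (p x : R * R) : R := p.1 * x.2 - p.2 * x.1.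

Definition dot {R : realType} (p x : R * R) : R := p.1 * x.1 + p.2 * x.2.

Lemma dot_gt0 {R : realType} (p : R * R) : p != 0 -> 0 < dot p p.
Proof.
case: p => x y p0; rewrite /dot /= -!expr2 lt0r paddr_eq0 ?sqr_ge0 // !sqrf_eq0 addr_ge0 ?sqr_ge0 //.
by rewrite andbT; apply: contra p0 => /andP[/eqP -> /eqP ->].
Qed.

Lemma cross_eq0_parallel {R : realType} (p x : R * R) : p != 0 -> cross p x = 0 ->
  x = (dot p x / dot p p) *: p.
Proof.
move=> p0 c0; have d0 := dot_gt0 p p0.
have dn0 : dot p p != 0 by rewrite gt_eqF.
move: c0 dn0; case: p {p0 d0} => a b; case: x => x y; rewrite /cross /dot /= => c0 dn0.
congr (_, _); rewrite /= -![_ *: _]/(_ * _).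
  apply: (mulIf dn0); rewrite mulrAC divfK //.
  have -> : x * (a * a + b * b) = (a * x + b * y) * a - b * (a * y - b * x) by ring.
  by rewrite c0 mulr0 subr0.
apply: (mulIf dn0); rewrite mulrAC divfK //.
have -> : y * (a * a + b * b) = (a * x + b * y) * b + a * (a * y - b * x) by ring.
by rewrite c0 mulr0 addr0.
Qed.

Lemma normr_dot_le {R : realType} (p x : R * R) : `|dot p x| <= 2 * `|p| * `|x|.
Proof.
rewrite /dot; apply: le_trans (ler_normD _ _) _; rewrite !normrM.
have h1 := ler_pM (normr_ge0 p.1) (normr_ge0 x.1) (prod_norm_fst p) (prod_norm_fst x).
have h2 := ler_pM (normr_ge0 p.2) (normr_ge0 x.2) (prod_norm_snd p) (prod_norm_snd x).
lra.
Qed.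

Lemma normr_cross_le {R : realType} (p x : R * R) : `|cross p x| <= 2 * `|p| * `|x|.
Proof.
rewrite /cross; apply: le_trans (ler_normB _ _) _; rewrite !normrM.
have h1 := ler_pM (normr_ge0 p.1) (normr_ge0 x.2) (prod_norm_fst p) (prod_norm_snd x).
have h2 := ler_pM (normr_ge0 p.2) (normr_ge0 x.1) (prod_norm_snd p) (prod_norm_fst x).
lra.
Qed.

Lemma prod_norm_sqr_le_dot {R : realType} (p : R * R) : `|p| ^+ 2 <= dot p p.
Proof. by rewrite /dot -!expr2; exact: prod_norm_sqr_le. Qed.

Section InvariantRays.
Context {R : realType} (lam : R) (m : nat) (q : R * R -> R * R).
Hypothesis lam_gt0 : 0 < lam.
Hypothesis m_gt0 : (0 < m)%N.
Hypothesis q_hom : forall (c : R) p, q (c *: p) = c ^+ m.+1 *: q p.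
Hypothesis q_lip : locally_lipschitz q.

Let F := star_field lam q.

(** If the homogeneous part is radial along p, then cross p (q u) is controlled by
the distance of u to the line of p, and cross p u satisfies a linear
differential inequality. *)
Lemma invariant_line (p : R * R) (u : R -> R * R) (B t : R) :
  p != 0 -> cross p (q p) = 0 ->
  (forall s : R, is_derive s 1 u (F (u s))) -> (forall s, `|u s| <= B) ->
  cross p (u 0) = 0 -> cross p (u t) = 0.
Proof.
move=> p0 cq du uB cu0.
have B0 : 0 <= B by apply: le_trans (uB 0).
have [L L0 LE] := q_lip (2 * B).
have d0 := dot_gt0 p p0.
have np0 : 0 < `|p| by rewrite normr_gt0.
pose w s := cross p (u s).
pose dw s := lam * w s + cross p (q (u s)).
have dwE (s : R) : is_derive s 1 w (dw s).
  have /is_derive_pairE[? ?] := du s.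
  apply: is_derive_eq; rewrite -![_ *: _]/(_ * _) /dw /w /F /star_field /cross /= -![_ *: _]/(_ * _).
  ring.
have bound s : `|cross p (q (u s))| <= 2 * L * `|w s|.
  (* c p is the orthogonal projection of u s to the line of p. *)
  pose c := dot p (u s) / dot p p.
  have -> : cross p (q (u s)) = cross p (q (u s) - q (c *: p)).
    move: cq; rewrite q_hom /cross /= -![_ *: _]/(_ * _) => cq.
    have -> : p.1 * ((q (u s)).2 - c ^+ m.+1 * (q p).2) - p.2 * ((q (u s)).1 - c ^+ m.+1 * (q p).1)
       = p.1 * (q (u s)).2 - p.2 * (q (u s)).1 - c ^+ m.+1 * (p.1 * (q p).2 - p.2 * (q p).1) by ring.
    by rewrite cq mulr0 subr0.
  apply: le_trans (normr_cross_le _ _) _.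
  have cB : `|c *: p| <= 2 * B.
    rewrite normrZ /c normrM normfV (gtr0_norm d0) mulrAC ler_pdivrMr //.
    have h := normr_dot_le p (u s).
    have := ler_wpM2r (ltW np0) h.
    have := ler_wpM2l (mulr_ge0 (ler0n R 2) B0) (prod_norm_sqr_le_dot p).
    have := ler_wpM2l (sqr_ge0 `|p|) (uB s).
    nra.
  have le1 : `|q (u s) - q (c *: p)| <= L * `|u s - c *: p|.
    by apply: LE => //; apply: le_trans (uB s) _; lra.
  have E : `|p| * `|u s - c *: p| <= `|w s|.
    have -> : u s - c *: p = (w s / dot p p) *: (- p.2, p.1).
      rewrite /w /c /cross /dot; move: d0; rewrite /dot.
      case: (p) (u s) => a b [x y] /= d0.
      by congr (_, _); rewrite /= -![_ *: _]/(_ * _); field; lra.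
    rewrite normrZ normrM normfV (gtr0_norm d0) [X in _ * (_ * X)](_ : _ = `|p|); last first.
      by rewrite !prod_normE /= normrN maxC.
    have -> : `|p| * (`|w s| / dot p p * `|p|) = `|w s| * (`|p| ^+ 2 / dot p p) by ring.
    rewrite ler_piMr //.
    by rewrite ler_pdivrMr // mul1r prod_norm_sqr_le_dot.
  have := ler_wpM2l (ltW np0) le1; have := ler_wpM2l L0 E; nra.
have k0 : 0 <= 2 * (lam + 2 * L) by rewrite mulr_ge0 // addr_ge0 ?mulr_ge0 // ltW.
have : w t ^+ 2 <= w 0 ^+ 2 * expR (2 * (lam + 2 * L) * `|t - 0|).
  apply: (@gronwall R setT (fun s => w s ^+ 2) (fun s => 2 * (w s * dw s))) => // s _.
    have ? := dwE s; apply: is_derive_eq; rewrite -![_ *: _]/(_ * _) /= !mulr_natl; ring.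
  rewrite normrM ger0_norm // -mulrA ler_pM2l // normrM.
  have h : `|dw s| <= (lam + 2 * L) * `|w s|.
    apply: le_trans (ler_normD _ _) _.
    by rewrite normrM gtr0_norm // mulrDl lerD2l bound.
  have := ler_wpM2l (normr_ge0 (w s)) h.
  by rewrite mulrCA -expr2 real_normK ?num_real.
rewrite /w cu0 expr0n mul0r real_exprn_even_le0 ?num_real //= => /eqP; exact.
Qed.

(** The orbit of p stays on its ray and in C, so by uniqueness of the intersection
it does not move. *)
Lemma invariant_ray_equilibrium (C : set (R * R)) (p : R * R) :
  punctured_compact C -> solution_invariant F C -> C p ->
  cross p (q p) = 0 -> F p = 0.
Proof.
move=> pcC inv Cp cq.
have q_hom' : positively_homogeneous m.+1 q by move=> c x _; exact: q_hom.
have [u [u0 du Cu]] := invariant_orbit lam q lam_gt0 q_lip C p pcC inv Cp.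
have p0 : p != 0 by apply: contraPneq Cp => ->; case: pcC.
have [B BE] : exists B, forall p, C p -> `|p| <= B by case: pcC.
have d0 := dot_gt0 p p0.
pose c t := dot p (u t) / dot p p.
have uE t : u t = c t *: p.
  apply: cross_eq0_parallel => //; apply: (@invariant_line p u B t) => // [s|].
    exact/BE/Cu.
  by rewrite u0 /cross; ring.
have c0 : c 0 = 1 by rewrite /c u0 divff // gt_eqF.
have cc : {for 0, continuous c}.
  apply: (@is_derive_continuous _ _ _ _ (dot p (F (u 0)) / dot p p)).
  have /is_derive_pairE[? ?] := du 0.
  by apply: is_derive_eq; rewrite -![_ *: _]/(_ * _) /dot; field; rewrite gt_eqF.
have up : \forall t \near (0 : R), p = u t.
  have h : \forall t \near (0 : R), 0 < c t.
    by apply: (@cvgr_gt _ _ (nbhs (0:R)) _ c (c 0) cc); rewrite c0.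
  apply: filterS h => t ct; rewrite uE.
  rewrite (@invariant_meets_ray_once R lam m q lam_gt0 m_gt0 q_hom' q_lip C p (c t)) ?scale1r //.
  by rewrite -uE.
have dc : is_derive (0:R) 1 u 0.
  exact: (near_eq_is_derive up).
have := du 0; rewrite u0 => -[_ h1]; case: dc => _ h2.
exact: etrans (esym h1) h2.
Qed.

End InvariantRays.

(** * Closed curves that meet each ray at most once *)

Definition euclidean_norm {R : realType} (p : R * R) : R := Num.sqrt (dot p p).

Lemma euclidean_norm_gt0 {R : realType} (p : R * R) : p != 0 -> 0 < euclidean_norm p.
Proof. by move=> p0; rewrite sqrtr_gt0 dot_gt0. Qed.

Lemma sqr_euclidean_norm {R : realType} (p : R * R) : euclidean_norm p ^+ 2 = dot p p.
Proof. by rewrite sqr_sqrtr // /dot -!expr2 addr_ge0 ?sqr_ge0. Qed.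

Lemma lagrange_identity {R : realType} (e p : R * R) :
  dot e p ^+ 2 + cross e p ^+ 2 = (euclidean_norm e * euclidean_norm p) ^+ 2.
Proof. by rewrite exprMn !sqr_euclidean_norm /dot /cross; ring. Qed.

(** The equality case of the Cauchy-Schwarz inequality. *)
Lemma dot_lt_euclidean_norm {R : realType} (e p : R * R) : e != 0 -> p != 0 ->
  (forall kap : R, 0 < kap -> p != kap *: e) -> dot e p < euclidean_norm e * euclidean_norm p.
Proof.
move=> e0 p0 nray; rewrite ltNge; apply/negP => le.
have Ne := euclidean_norm_gt0 _ e0; have Np := euclidean_norm_gt0 _ p0.
have s0 : 0 < euclidean_norm e * euclidean_norm p by rewrite mulr_gt0.
have d0 : 0 < dot e p by lra.
have L := lagrange_identity e p.
have c0 : cross e p = 0.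
  apply/eqP; rewrite -sqrf_eq0 eq_le sqr_ge0 andbT.
  have : (euclidean_norm e * euclidean_norm p) ^+ 2 <= dot e p ^+ 2 by rewrite lerXn2r ?nnegrE // ltW.
  by lra.
have := nray (dot e p / dot e e).
by rewrite divr_gt0 ?dot_gt0 // -(cross_eq0_parallel e p) // eqxx => /(_ isT).
Qed.

(** The stereographic projection of p / |p| from the point e / |e| of the unit
circle. *)
Definition stereographic {R : realType} (e p : R * R) : R :=
  cross e p / (euclidean_norm e * euclidean_norm p - dot e p).

(** The rational parametrization of the circle of radius s, which recovers a point
from its stereographic projection t. *)
Lemma stereographic_param {R : realType} (s a b : R) : 0 < s - a -> a ^+ 2 + b ^+ 2 = s ^+ 2 ->
  let t := b / (s - a) in a = s * ((t ^+ 2 - 1) / (t ^+ 2 + 1)) /\ b = s * (2 * t / (t ^+ 2 + 1)).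
Proof.
move=> sa E t.
have t1 : t ^+ 2 + 1 != 0 by rewrite gt_eqF // ltr_wpDl ?sqr_ge0.
have bt : b = t * (s - a) by rewrite /t divfK // gt_eqF.
have t2 : t ^+ 2 * (s - a) = s + a.
  apply: (mulIf (_ : s - a != 0)); first by rewrite gt_eqF.
  have -> : t ^+ 2 * (s - a) * (s - a) = (t * (s - a)) ^+ 2 by ring.
  rewrite -bt; have -> : b ^+ 2 = s ^+ 2 - a ^+ 2 by rewrite -E; ring.
  ring.
have aE : a = s * ((t ^+ 2 - 1) / (t ^+ 2 + 1)).
  apply: (mulIf t1); rewrite -mulrA divfK //.
  have -> : a * (t ^+ 2 + 1) = s * t ^+ 2 + a - t ^+ 2 * (s - a) by ring.
  by rewrite t2; ring.
split=> //.
apply: (mulIf t1); rewrite -[RHS]mulrA divfK // bt.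
have -> : t * (s - a) * (t ^+ 2 + 1) = t * (t ^+ 2 * (s - a) + (s - a)) by ring.
by rewrite t2; ring.
Qed.

Lemma stereographic_inj {R : realType} (e p p' : R * R) : e != 0 -> p != 0 -> p' != 0 ->
  dot e p < euclidean_norm e * euclidean_norm p -> dot e p' < euclidean_norm e * euclidean_norm p' ->
  stereographic e p = stereographic e p' -> exists2 kap, 0 < kap & p' = kap *: p.
Proof.
move=> e0 p0 p'0; rewrite -subr_gt0 => dp; rewrite -subr_gt0 => dp' E.
have Ne := euclidean_norm_gt0 _ e0; have Np := euclidean_norm_gt0 _ p0; have Np' := euclidean_norm_gt0 _ p'0.
have [aE bE] := stereographic_param _ _ _ dp (lagrange_identity e p).
have [aE' bE'] := stereographic_param _ _ _ dp' (lagrange_identity e p').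
rewrite -/(stereographic e p) in aE bE.
rewrite -/(stereographic e p') -E in aE' bE'.
set A := (_ / _) in aE aE'; set B := (_ / _) in bE bE'.
exists (euclidean_norm p' / euclidean_norm p); first by rewrite divr_gt0.
have dn := dot_gt0 e e0.
(* Coordinates in the orthogonal basis formed by e and its rotation by pi/2. *)
have sd (x : R * R) : x = (dot e e)^-1 *: (dot e x * e.1 - cross e x * e.2, dot e x * e.2 + cross e x * e.1).
  have : dot e e != 0 by rewrite gt_eqF.
  rewrite /dot /cross; case: (e) x => a b [x y] /= h.
  by congr (_, _); rewrite /= -![_ *: _]/(_ * _); field.
apply: (etrans (sd p')); apply/esym/(etrans (congr1 (GRing.scale _) (sd p))).
rewrite aE bE aE' bE'.
by congr (_, _); rewrite /= -![_ *: _]/(_ * _); field; rewrite !gt_eqF.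
Qed.

Lemma euclidean_norm_continuous {R : realType} : continuous (@euclidean_norm R).
Proof.
move=> p.
have c1 : (fun x : R * R => x.1) @ p --> p.1 by exact: cvg_fst.
have c2 : (fun x : R * R => x.2) @ p --> p.2 by exact: cvg_snd.
apply: (@continuous_comp _ _ _ (fun x => dot x x) Num.sqrt); last exact: sqrt_continuous.
by apply: cvgD; apply: cvgM.
Qed.

Lemma stereographic_continuous {R : realType} (e p : R * R) : dot e p < euclidean_norm e * euclidean_norm p ->
  {for p, continuous (stereographic e)}.
Proof.
rewrite -subr_gt0 => d0.
have c1 : (fun x : R * R => x.1) @ p --> p.1 by exact: cvg_fst.
have c2 : (fun x : R * R => x.2) @ p --> p.2 by exact: cvg_snd.
have cN : euclidean_norm @ p --> euclidean_norm p by exact: euclidean_norm_continuous.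
apply: cvgM; first by apply: cvgB; apply: cvgM => //; exact: cvg_cst.
apply: cvgV; first by rewrite gt_eqF.
apply: cvgB; first by apply: cvgM => //; exact: cvg_cst.
by apply: cvgD; apply: cvgM => //; exact: cvg_cst.
Qed.

(** If the ray of e is missed, the stereographic projection from e is continuous
and injective on C.  Along the curve it takes the value halfway between its
values at the parameters 0 and 1/2 once on either side of 1/2. *)
Lemma closed_curve_meets_every_ray {R : realType} (C : set (R * R)) (e : R * R) :
  simple_closed_curve C -> ~ C 0 ->
  (forall p (kap : R), C p -> C (kap *: p) -> 0 < kap -> kap = 1) ->
  e != 0 -> exists2 kap : R, 0 < kap & C (kap *: e).
Proof.
move=> [c [cc c01 cinj CE]] C0 ray e0.
apply/not_exists2P => nray.
have Cc x : 0 <= x <= 1 -> C (c x) by move=> x01; rewrite CE; exists x => //=; rewrite in_itv.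
have nz p : C p -> p != 0 by move=> Cp; apply: contraPneq Cp => ->.
have lt p : C p -> dot e p < euclidean_norm e * euclidean_norm p.
  move=> Cp; apply: dot_lt_euclidean_norm => //; first exact: nz.
  by move=> kap kap0; apply: contraPneq Cp => -> ?; case: (nray kap).
pose psi x := stereographic e (c x).
have cpsi : {within `[0, 1], continuous psi}.
  apply/subspace_continuousP => x /= x01.
  move/subspace_continuousP : cc => /(_ x x01) cx.
  apply: (cvg_comp _ _ cx); apply: stereographic_continuous.
  by apply/lt/Cc; move: x01; rewrite in_itv.
have psi_inj x y : 0 <= x < 1 -> 0 <= y < 1 -> psi x = psi y -> x = y.
  move=> /andP[x0 x1] /andP[y0 y1] E.
  have Cx : C (c x) by apply: Cc; rewrite x0 ltW.
  have Cy : C (c y) by apply: Cc; rewrite y0 ltW.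
  have [kap kap0 cyx] := stereographic_inj _ _ _ e0 (nz _ Cx) (nz _ Cy) (lt _ Cx) (lt _ Cy) E.
  have k1 : kap = 1 by apply: (ray (c x)) => //; rewrite -cyx.
  apply: cinj; rewrite ?in_itv /= ?x0 ?y0 ?x1 ?y1 //.
  by rewrite cyx k1 scale1r.
have psi01 : psi 1 = psi 0 by rewrite /psi c01.
have half0 : psi (2^-1) != psi 0.
  by apply/eqP => /psi_inj H; have : 2^-1 = 0 :> R by [apply: H; lra]; lra.
pose v := (psi 0 + psi 2^-1) / 2.
have [|||x x0 xv] := @IVT R psi 0 2^-1 v.
- by lra.
- by apply: continuous_subspaceW cpsi => x /=; rewrite !in_itv /=; lra.
- by rewrite /v; case: (leP (psi 0)) => ?; lra.
have [|||y y0 yv] := @IVT R psi 2^-1 1 v.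
- by lra.
- by apply: continuous_subspaceW cpsi => y /=; rewrite !in_itv /=; lra.
- by rewrite /v psi01; case: (leP (psi 2^-1)) => ?; lra.
rewrite in_itv /= in x0; rewrite in_itv /= in y0.
have half_v : psi 2^-1 != v by apply: contra half0 => /eqP; rewrite /v => h; apply/eqP; lra.
have zero_v : psi 0 != v by apply: contra half0 => /eqP; rewrite /v => h; apply/eqP; lra.
have x2 : x != 2^-1 by apply: contra half_v => /eqP <-; rewrite xv.
have y1 : y != 1 by apply: contra zero_v => /eqP E; rewrite -psi01 -E yv.
have xy : x = y.
  apply: psi_inj; rewrite ?xv ?yv //; first lra.
  by move: y1; rewrite lt_neqAle => ->; lra.
by move/eqP : x2; apply; lra.
Qed.

(** * Attraction *)

Lemma is_derive_shift_arg {R : realType} (u : R -> R * R) (t0 t : R) (l : R * R) :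
  is_derive (t - t0) 1 u l -> is_derive t 1 (fun s => u (s - t0)) l.
Proof. by rewrite !is_deriveE; under [in X in _ -> X]eq_fun do rewrite -addrA. Qed.

Lemma solution_shift {R : realType} (F : R * R -> R * R) (I : set R) (u : R -> R * R) (t0 : R) :
  solution F I u -> solution F [set t | I (t - t0)] (fun t => u (t - t0)).
Proof.
move=> [oI itvI du]; split.
- apply: (@open_comp _ _ (fun t => t - t0) I) => // t _.
  by apply: cvgB; [exact: cvg_id|exact: cvg_cst].
- move=> x y /= Ix Iy z /andP[xz zy]; apply: (itvI _ _ Ix Iy); lra.
- by move=> t /= It; apply: is_derive_shift_arg; exact: du.
Qed.

(** x - 1 divides x^m - 1, with a quotient that is at least 1. *)
Lemma dist1_le_expr {R : realType} (x : R) (m : nat) : (0 < m)%N -> 0 <= x ->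
  `|x - 1| <= `|x ^+ m - 1|.
Proof.
case: m => // m _ x0; rewrite -[X in _ ^+ _ - X](expr1n _ m.+1) subrXX normrM.
rewrite ler_peMr // big_ord_recr /= subnn expr0 mul1r expr1n ger0_norm.
  by rewrite lerDr sumr_ge0 // => i _; rewrite mulr_ge0 ?exprn_ge0.
by rewrite addr_ge0 // sumr_ge0 // => i _; rewrite mulr_ge0 ?exprn_ge0.
Qed.

Section Attraction.
Context {R : realType} (lam : R) (m : nat) (q : R * R -> R * R).
Hypothesis lam_gt0 : 0 < lam.
Hypothesis m_gt0 : (0 < m)%N.
Hypothesis q_hom : positively_homogeneous m.+1 q.
Hypothesis q_lip : locally_lipschitz q.

Let F := star_field lam q.
Let mu : R := m%:R * lam.

(** Scale the orbit of the point of C on the same ray to get the solution: it is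
defined for all later times, and at time t it is at distance |r - 1| |c| from a
point c of C, where r^m = kap^m e^(mu t) / ray_clock tends to 1. *)
Lemma invariant_attracting (C : set (R * R)) (I : set R) (u : R -> R * R) (t0 : R) :
  punctured_compact C -> solution_invariant F C ->
  (forall e : R * R, e != 0 -> exists2 kap : R, 0 < kap & C (kap *: e)) ->
  trajectory F I u -> I t0 -> u t0 != 0 -> forward_asymptotic I u C.
Proof.
move=> pcC inv meets traj It0 ut0.
have mu0 : 0 < mu by rewrite mulr_gt0 // ltr0n.
have [kap' kap'0 Cu] := meets _ ut0.
pose kap := kap'^-1; have kap0 : 0 < kap by rewrite invr_gt0.
have [v [v0 dv Cv]] := invariant_orbit lam q lam_gt0 q_lip C _ pcC inv Cu.
have [B BE] : exists B, forall p, C p -> `|p| <= B by case: pcC.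
have B0 : 0 <= B by apply: le_trans (BE _ Cu).
pose k := kap ^+ m; have k0 : 0 < k by rewrite exprn_gt0.
have solZ := rescaled_solves lam m q lam_gt0 m_gt0 q_hom kap v kap0 dv.
have FL := star_field_lipschitz lam q lam_gt0 q_lip.
have [||SI uZ] := trajectory_contains F I _ u _ t0 FL traj (solution_shift _ _ _ t0 solZ) It0.
- by rewrite /= subrr ray_clock0.
- by rewrite subrr rescaled0 v0 scalerA mulVf ?scale1r // gt_eqF.
have clock_ge t : 0 <= t -> 1 + k * (mu * t) <= ray_clock mu k t.
  by move=> tp; rewrite /ray_clock lerD2l ler_pM2l // lerBrDl expR_ge1Dx.
have clock_gt0 t : 0 <= t -> 0 < ray_clock mu k t.
  move=> tp; apply: lt_le_trans (clock_ge t tp).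
  by rewrite ltr_wpDr // mulr_ge0 ?(ltW k0) // mulr_ge0 // ltW.
split.
  near=> t; apply: SI; apply: clock_gt0; rewrite subr_ge0.
  by near: t; apply: nbhs_pinfty_ge; exact: num_real.
move=> eps eps0; near=> t.
have tp : 0 <= t - t0.
  by rewrite subr_ge0; near: t; apply: nbhs_pinfty_ge; exact: num_real.
have den0 := clock_gt0 _ tp.
exists (v (ln (ray_clock mu k (t - t0)) / mu)); first exact: Cv.
rewrite uZ; last exact: clock_gt0.
rewrite /rescaled -/mu -/k; set s := ln _ / mu.
rewrite -[X in _ - X]scale1r -scalerBl normrZ.
set r := kap * _.
have r0 : 0 <= r by rewrite mulr_ge0 ?expR_ge0 // ltW.
have rm : r ^+ m = k * expR (mu * (t - t0)) / ray_clock mu k (t - t0).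
  rewrite /r exprMn -expRM_natl -/k -mulrA; congr (_ * _).
  have -> : m%:R * (lam * (t - t0 - s)) = mu * (t - t0) - ln (ray_clock mu k (t - t0)).
    rewrite /s /mu; field.
    by rewrite pnatr_eq0 -lt0n m_gt0 gt_eqF.
  by rewrite expRD expRN lnK ?posrE.
have rB : `|r - 1| <= `|k - 1| / ray_clock mu k (t - t0).
  apply: le_trans (dist1_le_expr _ _ m_gt0 r0) _.
  rewrite rm [X in `|X|](_ : _ = (k - 1) / ray_clock mu k (t - t0)); last first.
    have := den0; rewrite /ray_clock => ?; field; lra.
  by rewrite normrM normfV (gtr0_norm den0).
apply: (@le_lt_trans _ _ (`|k - 1| / ray_clock mu k (t - t0) * B)).
  by rewrite ler_pM // BE.
rewrite mulrAC ltr_pdivrMr //.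
apply: (@lt_le_trans _ _ (eps * (1 + k * (mu * (t - t0))))); last first.
  by rewrite ler_pM2l // clock_ge.
have : `|k - 1| * B / (eps * k * mu) <= t - t0.
  rewrite lerBrDr.
  by near: t; apply: nbhs_pinfty_ge; exact: num_real.
rewrite ler_pdivrMr ?(mulr_gt0 (mulr_gt0 eps0 k0) mu0) // => h.
have : (t - t0) * (eps * k * mu) = eps * (k * (mu * (t - t0))) by ring.
by lra.
Unshelve. all: by end_near. Qed.

End Attraction.

(** * The angular equation *)

Lemma derive_bounded_lipschitz {R : realType} (f df : R -> R) (K a b : R) :
  (forall t : R, is_derive t 1 f (df t)) -> (forall t, `|df t| <= K) ->
  `|f a - f b| <= K * `|a - b|.
Proof.
move=> dfE dfK.
wlog ab : a b / b <= a.
  move=> H; have [|/ltW ba] := leP b a; first exact: H.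
  by rewrite distrC (distrC a b); exact: H.
have [|c _ ->] := @MVT_segment R f df b a ab _ _.
  by apply: continuous_subspaceT => x; apply: is_derive_continuous; exact: dfE.
by rewrite normrM ler_wpM2r.
Qed.

Lemma unit_vec_lipschitz {R : realType} (a b : R) : `|unit_vec a - unit_vec b| <= `|a - b|.
Proof.
rewrite prod_norm_le /=; apply/andP; split; rewrite -[X in _ <= X]mul1r.
  apply: (@derive_bounded_lipschitz R cos (fun t => - sin t)) => t.
  by rewrite normrN ler_norml sin_geN1 sin_le1.
by apply: (@derive_bounded_lipschitz R sin cos) => t; rewrite ler_norml cos_geN1 cos_le1.
Qed.

Lemma normr_unit_vec {R : realType} (a : R) : 2^-1 <= `|unit_vec a| <= 1.
Proof.
apply/andP; split; last first.
  by rewrite prod_norm_le /= !ler_norml sin_geN1 sin_le1 cos_geN1 cos_le1.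
have := prod_norm_sqr_ge (unit_vec a); rewrite /= cos2Dsin2 => h.
rewrite leNgt; apply/negP => lt.
have : `|unit_vec a| ^+ 2 <= `|unit_vec a| * 2^-1.
  by rewrite expr2 ler_wpM2l // ltW.
lra.
Qed.

Lemma dot_unit_vec {R : realType} (a : R) : dot (unit_vec a) (unit_vec a) = 1.
Proof. by rewrite /dot -!expr2 cos2Dsin2. Qed.

Lemma unit_vec_neq0 {R : realType} (a : R) : unit_vec a != 0.
Proof.
apply/negP => /eqP E; have := dot_unit_vec a.
by rewrite E /dot /= mulr0 addr0 => /eqP; rewrite eq_sym oner_eq0.
Qed.

Lemma unit_vecD2pi {R : realType} (a : R) : unit_vec (a + pi *+ 2) = unit_vec a.
Proof. by rewrite /unit_vec cosD2pi sinD2pi. Qed.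

(** Near a zero of g the function f is negative, and elsewhere a large multiple
of |g| dominates it; compactness makes the multiple uniform and the inequality
strict by a constant. *)
Lemma dissipation_bound {R : realType} (f g : R -> R) (a b : R) : a <= b ->
  continuous f -> continuous g -> (forall x, a <= x <= b -> g x = 0 -> f x < 0) ->
  exists c A, [/\ 0 < c, 0 <= A & forall x, a <= x <= b -> f x <= - c + A * `|g x|].
Proof.
move=> ab cf cg fneg.
have K := @segment_compact R a b.
have near_cover := (compact_near_coveringP `[a, b]).1 K _ (pinfty_nbhs R)
  (fun k x => 0 <= k /\ f x - k * `|g x| < 0) _.
have : \forall k \near +oo, `[a, b] `<=` (fun x => 0 <= k /\ f x - k * `|g x| < 0).
  apply: near_cover => x /=; rewrite in_itv /= => xab.
  have [gx0|gx0] := eqVneq (g x) 0.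
    have fx := fneg x xab gx0.
    have h : \forall y \near x, f y < 0.
      by apply: (@cvgr_lt _ _ (nbhs x) _ f (f x) (cf x)).
    exists ([set y | f y < 0], [set k | 0 <= k]) => //=.
      split => //; apply: nbhs_pinfty_ge; exact: num_real.
    move=> [y k] /= [fy k0]; split => //.
    by have := mulr_ge0 k0 (normr_ge0 (g y)); lra.
  have gx : 0 < `|g x| by rewrite normr_gt0.
  have h1 : \forall y \near x, `|g x| / 2 < `|g y|.
    by apply: (@cvgr_norm_gt _ _ _ (nbhs x) _ g (g x) (cg x)); lra.
  have h2 : \forall y \near x, f y < `|f x| + 1.
    apply: (@cvgr_lt _ _ (nbhs x) _ f (f x) (cf x)).
    by have := ler_norm (f x); lra.
  exists ([set y | `|g x| / 2 < `|g y| /\ f y < `|f x| + 1],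
    [set k | (`|f x| + 1) / (`|g x| / 2) <= k]) => /=.
    split; first by apply: filterI.
    apply: nbhs_pinfty_ge; exact: num_real.
  move=> [y k] /= [[gy fy] kE].
  have k0 : 0 <= k.
    by apply: le_trans kE; rewrite !divr_ge0 // addr_ge0.
  split => //.
  rewrite ler_pdivrMr ?divr_gt0 // in kE.
  by have := ler_wpM2l k0 (ltW gy); lra.
move=> /filter_ex[A Ale].
have A0 : 0 <= A by have [] := Ale a; rewrite //= in_itv /= lexx.
pose h x := f x - A * `|g x|.
have ch : continuous h.
  move=> x; apply: cvgB; first exact: cf.
  by apply: cvgM; [exact: cvg_cst|apply: cvg_norm; exact: cg].
have [|y yab ymax] := @EVT_max R h a b ab; first exact: continuous_subspaceT.
exists (- h y), A; split => //; last first.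
  move=> x xab; have := ymax x; rewrite in_itv /= xab => /(_ isT).
  by rewrite /h; lra.
by rewrite oppr_gt0; case: (Ale y).
Qed.

Lemma continuous_crossing {R : realType} (f : R -> R) (a b v : R) :
  continuous f -> f a <= v <= f b -> exists c, f c = v.
Proof.
move=> cf /andP[av vb].
have [ab|/ltW ba] := leP a b.
  have [||c _ cv] := @IVT R f a b v ab; last by exists c.
    exact: continuous_subspaceT.
  by rewrite ge_min le_max av vb orbT.
have [||c _ cv] := @IVT R f b a v ba; last by exists c.
  exact: continuous_subspaceT.
by rewrite ge_min le_max av vb !orbT.
Qed.

(** Gronwall's inequality for the square of the distance to the equilibrium. *)
Lemma scalar_equilibrium {R : realType} (g Th : R -> R) (K t1 t : R) : 0 <= K ->
  (forall x y, `|g x - g y| <= K * `|x - y|) ->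
  (forall s : R, is_derive s 1 Th (g (Th s))) -> g (Th t1) = 0 -> Th t = Th t1.
Proof.
move=> K0 gK dTh g0.
apply/eqP; rewrite -subr_eq0 -sqrf_eq0 eq_le sqr_ge0 andbT.
have : (Th t - Th t1) ^+ 2 <= (Th t1 - Th t1) ^+ 2 * expR (2 * K * `|t - t1|).
  apply: (@gronwall R setT (fun s => (Th s - Th t1) ^+ 2)
    (fun s => 2 * ((Th s - Th t1) * g (Th s)))) => // s _.
    have ? := dTh s; apply: is_derive_eq; rewrite -![_ *: _]/(_ * _) /= !mulr_natl; ring.
  rewrite normrM ger0_norm // -mulrA ler_pM2l // normrM.
  have := gK (Th s) (Th t1); rewrite g0 subr0 => h.
  have := ler_wpM2l (normr_ge0 (Th s - Th t1)) h.
  by rewrite mulrCA -expr2 real_normK ?num_real.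
by rewrite subrr expr0n mul0r.
Qed.

Lemma trapped_flow {R : realType} (g Th : R -> R) (K a b t : R) : 0 <= K ->
  (forall x y, `|g x - g y| <= K * `|x - y|) ->
  (forall s : R, is_derive s 1 Th (g (Th s))) -> g a = 0 -> g b = 0 ->
  a <= Th 0 <= b -> a <= Th t <= b.
Proof.
move=> K0 gK dTh ga gb /andP[a0 b0].
have cTh : continuous Th by move=> s; apply: is_derive_continuous; exact: dTh.
apply/andP; split; rewrite leNgt; apply/negP => lt.
  have [|s sE] := @continuous_crossing R Th t 0 a cTh; first by rewrite (ltW lt).
  have cst := @scalar_equilibrium R g Th K s _ K0 gK dTh.
  by move: lt; rewrite cst sE // ltxx.
have [|s sE] := @continuous_crossing R Th 0 t b cTh; first by rewrite (ltW lt) b0.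
have cst := @scalar_equilibrium R g Th K s _ K0 gK dTh.
by move: lt; rewrite cst sE // ltxx.
Qed.

(** A change of sign of g(Th) would go through an equilibrium, at which the solution
stays; so |g(Th)| is, up to a constant sign, the derivative of Th. *)
Lemma flow_sign {R : realType} (g Th : R -> R) (K : R) : 0 <= K ->
  (forall x y, `|g x - g y| <= K * `|x - y|) -> continuous g ->
  (forall s : R, is_derive s 1 Th (g (Th s))) ->
  exists2 e : R, (e = 1 \/ e = -1) & forall s, `|g (Th s)| = e * g (Th s).
Proof.
move=> K0 gK cg dTh.
have cTh : continuous Th by move=> s; apply: is_derive_continuous; exact: dTh.
have cgTh : continuous (g \o Th).
  by move=> s; apply: continuous_comp; [exact: cTh|exact: cg].
have [[s0 gs0]|nz] := pselect (exists s, g (Th s) = 0).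
  exists 1; first by left.
  by move=> s; rewrite (@scalar_equilibrium R g Th K s0 s K0 gK dTh gs0) gs0 normr0 mulr0.
have nz' s : g (Th s) != 0 by apply/eqP => ?; apply: nz; exists s.
have [g0|g0] := ltP 0 (g (Th 0)).
  exists 1; first by left.
  move=> s; rewrite mul1r ger0_norm // leNgt; apply/negP => lt.
  have [|r rE] := @continuous_crossing R _ s 0 0 cgTh; first by rewrite /= (ltW lt) ltW.
  by have := nz' r; rewrite -[g _]/((g \o Th) r) rE eqxx.
exists (-1); first by right.
move=> s; rewrite mulN1r ler0_norm // leNgt; apply/negP => lt.
have [|r rE] := @continuous_crossing R _ 0 s 0 cgTh; first by rewrite /= (ltW lt) g0.
by have := nz' r; rewrite -[g _]/((g \o Th) r) rE eqxx.
Qed.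

(** The term A |g(Th)| is A times plus or minus the derivative of Th, so that its
integral is at most A (b - a), whatever the time interval. *)
Lemma dissipative_along_flow {R : realType} (f g Th y : R -> R) (K a b c A : R) : 0 <= K ->
  (forall x y, `|g x - g y| <= K * `|x - y|) -> continuous g ->
  (forall s : R, is_derive s 1 Th (g (Th s))) ->
  (forall s : R, is_derive s 1 y (f (Th s))) ->
  (forall s, a <= Th s <= b) -> 0 <= A ->
  (forall x, a <= x <= b -> f x <= - c + A * `|g x|) ->
  forall s t, s <= t -> y t - y s <= - c * (t - s) + A * (b - a).
Proof.
move=> K0 gK cg dTh dy trap A0 fle s t st.
have [e e1 eE] := flow_sign g Th K K0 gK cg dTh.
have := @derive_nonincreasing R (fun r => y r - e * A * Th r + c * r)
  (fun r => f (Th r) - e * A * g (Th r) + c) s t st.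
have H1 r : s <= r <= t -> is_derive r 1 (fun r => y r - e * A * Th r + c * r)
    (f (Th r) - e * A * g (Th r) + c).
  move=> _; have ? := dTh r; have ? := dy r.
  by apply: is_derive_eq; rewrite -![_ *: _]/(_ * _); ring.
move=> /(_ H1) H.
have : y t - e * A * Th t + c * t <= y s - e * A * Th s + c * s.
  apply: H => r _; have := fle _ (trap r); rewrite eE.
  have -> : A * (e * g (Th r)) = e * A * g (Th r) by ring.
  lra.
have : e * A * (Th t - Th s) <= A * (b - a).
  rewrite mulrAC mulrC ler_wpM2l //.
  have /andP[? ?] := trap s; have /andP[? ?] := trap t.
  by case: e1 => ->; lra.
lra.
Qed.

(** * Orbits that stay in an annulus *)

(** S is the integral of e^(- m y) from - oo, obtained as B minus its infimum for a
primitive B.  The upper bound on the growth of y makes it finite, of order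
e^(- m y); the lower bound on the growth, used over the last unit of time, keeps
it of the same order from below. *)
Lemma ancient_clock {R : realType} (y : R -> R) (m : nat) (M c K : R) : (0 < m)%N ->
  0 < c -> 0 <= M -> continuous y ->
  (forall s t, s <= t -> - M * (t - s) <= y t - y s) ->
  (forall s t, s <= t -> y t - y s <= - c * (t - s) + K) ->
  exists2 S : R -> R, forall t : R, is_derive t 1 S (expR (- (m%:R * y t))) &
    forall t, expR (- (m%:R * M)) <= S t * expR (m%:R * y t) <= expR (m%:R * K) / (m%:R * c).
Proof.
move=> m0 c0 M0 cy ylo yhi.
have mp : 0 < m%:R :> R by rewrite ltr0n.
have mc0 : 0 < m%:R * c by rewrite mulr_gt0.
have [|B _ dB] := @primitive_exists R (fun t => expR (- (m%:R * y t))).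
  move=> t; apply: (@continuous_comp _ _ _ (fun t => - (m%:R * y t)) expR); last exact: continuous_expR.
  by apply: cvgN; apply: cvgM; [exact: cvg_cst|exact: cy].
have upper s t : s <= t -> B t - B s <= expR (- (m%:R * y t)) * (expR (m%:R * K) / (m%:R * c)).
  move=> st.
  (* Compare e^(- m y) with E, the exponential that bounds it before the time t. *)
  pose E r := expR (m%:R * K - m%:R * y t - m%:R * c * (t - r)).
  have := @derive_nonincreasing R (fun r => B r - E r / (m%:R * c))
    (fun r => expR (- (m%:R * y r)) - E r) s t st.
  have H1 r : s <= r <= t -> is_derive r 1 (fun r => B r - E r / (m%:R * c))
      (expR (- (m%:R * y r)) - E r).
    move=> _; have ? := dB r.
    by apply: is_derive_eq; rewrite -![_ *: _]/(_ * _) /E; field; rewrite !gt_eqF.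
  move=> /(_ H1) H.
  have : B t - E t / (m%:R * c) <= B s - E s / (m%:R * c).
    apply: H => r /andP[_ rt]; rewrite subr_le0 ler_expR.
    by have := ler_wpM2l (ltW mp) (yhi r t rt); lra.
  have : 0 <= E s / (m%:R * c) by rewrite divr_ge0 ?expR_ge0 // ltW.
  have -> : E t = expR (- (m%:R * y t)) * expR (m%:R * K).
    by rewrite /E subrr mulr0 subr0 addrC expRD.
  rewrite mulrA; lra.
(* Over the last unit of time y exceeds y t by at most M. *)
have lower t : expR (- (m%:R * y t)) * expR (- (m%:R * M)) <= B t - B (t - 1).
  have t1 : t - 1 <= t by rewrite gerBl.
  pose C := expR (- (m%:R * y t)) * expR (- (m%:R * M)).
  have := @derive_nondecreasing R (fun r => B r - C * r)
    (fun r => expR (- (m%:R * y r)) - C) (t - 1) t t1.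
  have H1 r : t - 1 <= r <= t -> is_derive r 1 (fun r => B r - C * r)
      (expR (- (m%:R * y r)) - C).
    move=> _; have ? := dB r.
    by apply: is_derive_eq; rewrite -![_ *: _]/(_ * _); ring.
  move=> /(_ H1) H.
  have : B (t - 1) - C * (t - 1) <= B t - C * t.
    apply: H => r /andP[tr rt]; rewrite subr_ge0 /C -expRD ler_expR.
    have h := ylo r t rt.
    have : M * (t - r) <= M * 1 by rewrite ler_wpM2l //; lra.
    move=> h2; have : y r <= y t + M by lra.
    by move=> /(ler_wpM2l (ltW mp)); lra.
  rewrite /C; lra.
have lbB t : lbound (range B) (B t - expR (- (m%:R * y t)) * (expR (m%:R * K) / (m%:R * c))).
  move=> _ [s _ <-].
  have [st|/ltW ts] := leP s t; first by have := upper s t st; lra.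
  have : B t <= B s.
    by apply: (@derive_nondecreasing R B (fun r => expR (- (m%:R * y r)))).
  have : 0 <= expR (- (m%:R * y t)) * (expR (m%:R * K) / (m%:R * c)).
    by rewrite mulr_ge0 ?expR_ge0 // divr_ge0 ?expR_ge0 // ltW.
  lra.
have infB t : inf (range B) <= B t.
  by apply: ge_inf; [exists (B 0 - expR (- (m%:R * y 0)) * (expR (m%:R * K) / (m%:R * c)))|exists t].
have Binf t : B t - expR (- (m%:R * y t)) * (expR (m%:R * K) / (m%:R * c)) <= inf (range B).
  by apply: lb_le_inf; [exists (B 0); exists 0|exact: lbB].
exists (fun t => B t - inf (range B)) => t.
  have ? := dB t.
  by apply: is_derive_eq; rewrite subr0.
have e0 := expR_gt0 (m%:R * y t).
apply/andP; split.
  rewrite -ler_pdivrMr // -expRN.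
  by have := lower t; have := infB (t - 1); lra.
rewrite -ler_pdivlMr // -expRN.
by have := Binf t; lra.
Qed.

Lemma is_derive_comp_plane {R : realType} (u : R -> R * R) (h : R -> R) (t d : R) (l : R * R) :
  is_derive (h t) 1 u l -> is_derive t 1 h d -> is_derive t 1 (fun s => u (h s)) (d *: l).
Proof.
move=> /is_derive_pairE[d1 d2] dh; apply/is_derive_pairE; split.
  have := @is_derive1_comp R (fun s => (u s).1) h t l.1 d d1 dh.
  by rewrite mulrC; exact.
have := @is_derive1_comp R (fun s => (u s).2) h t l.2 d d2 dh.
by rewrite mulrC; exact.
Qed.

Lemma angle_exists {R : realType} (p : R * R) : dot p p = 1 ->
  exists2 phi : R, 0 <= phi <= pi *+ 2 & unit_vec phi = p.
Proof.
case: p => x y; rewrite /dot /= -!expr2 => xy1.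
have x1 : -1 <= x <= 1.
  rewrite -ler_norml -(@expr_le1 _ 2) // real_normK ?num_real //.
  by have := sqr_ge0 y; lra.
have y2 : 1 - x ^+ 2 = y ^+ 2 by lra.
have ac0 := acos_ge0 x1; have acpi := acos_lepi x1.
have cac : cos (acos x) = x by apply: acosK; rewrite in_itv.
have p0 := pi_ge0 R.
have [y0|y0] := leP 0 y.
  exists (acos x); first by rewrite ac0 /= mulr2n; lra.
  by rewrite /unit_vec cac sin_acos // y2 sqrtr_sqr ger0_norm.
exists (- acos x + pi *+ 2); first by rewrite mulr2n; lra.
rewrite unit_vecD2pi /unit_vec cosN sinN cac sin_acos // y2 sqrtr_sqr ltr0_norm //.
by rewrite opprK.
Qed.

Lemma angle_exists_from {R : realType} (th0 : R) (p : R * R) : dot p p = 1 ->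
  exists2 phi : R, th0 <= phi <= th0 + pi *+ 2 & unit_vec phi = p.
Proof.
move=> p1.
have cs := cos2Dsin2 th0.
have [|phi phi02 E] := @angle_exists R (dot (unit_vec th0) p, cross (unit_vec th0) p).
  move: p1; rewrite /dot /cross; case: p => x y /= p1.
  have -> : (cos th0 * x + sin th0 * y) * (cos th0 * x + sin th0 * y) +
    (cos th0 * y - sin th0 * x) * (cos th0 * y - sin th0 * x) =
    (cos th0 ^+ 2 + sin th0 ^+ 2) * (x * x + y * y) by ring.
  by rewrite cs p1 mulr1.
exists (th0 + phi); first lra.
move: E; rewrite /unit_vec cosD sinD => -[-> ->].
rewrite /dot /cross; case: p {p1} => x y /=; congr (_, _).
  have -> : cos th0 * (cos th0 * x + sin th0 * y) - sin th0 * (cos th0 * y - sin th0 * x) =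
    (cos th0 ^+ 2 + sin th0 ^+ 2) * x by ring.
  by rewrite cs mul1r.
have -> : sin th0 * (cos th0 * x + sin th0 * y) + cos th0 * (cos th0 * y - sin th0 * x) =
  (cos th0 ^+ 2 + sin th0 ^+ 2) * y by ring.
by rewrite cs mul1r.
Qed.

Lemma expr_bounds {R : realType} (r lo hi : R) (m : nat) : (0 < m)%N -> 0 <= r ->
  lo <= r ^+ m <= hi -> Num.min 1 lo <= r <= Num.max 1 hi.
Proof.
move=> m0 r0 /andP[lor rhi]; rewrite ge_min le_max.
have [r1|/ltW r1] := leP r 1.
  have -> : lo <= r by apply: le_trans lor _; rewrite ler_iXnr.
  by rewrite orbT.
have -> : r <= hi by apply: le_trans _ rhi; rewrite ler_eXnr.
by rewrite r1 orbT.
Qed.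

Definition radial {R : realType} (q : R * R -> R * R) (th : R) : R :=
  dot (unit_vec th) (q (unit_vec th)).

Definition angular {R : realType} (q : R * R -> R * R) (th : R) : R :=
  cross (unit_vec th) (q (unit_vec th)).

Section AncientOrbits.
Context {R : realType} (lam : R) (m : nat) (q : R * R -> R * R).
Hypothesis lam_gt0 : 0 < lam.
Hypothesis m_gt0 : (0 < m)%N.
Hypothesis q_hom : positively_homogeneous m.+1 q.
Hypothesis q_lip : locally_lipschitz q.

Let F := star_field lam q.
Let mu : R := m%:R * lam.
Let f := radial q.
Let g := angular q.

Lemma angular_data_lipschitz : exists M, [/\ 0 <= M, forall a, `|f a| <= M,
  forall a b, `|f a - f b| <= M * `|a - b| & forall a b, `|g a - g b| <= M * `|a - b|].
Proof.
have [L L0 LE] := q_lip 1.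
have q0 : q 0 = 0.
  by have := q_hom 0 0 (lexx _); rewrite scaler0 expr0n /= scale0r.
have e1 (a : R) : `|unit_vec a| <= 1 by case/andP: (normr_unit_vec a).
have qe a : `|q (unit_vec a)| <= L.
  have := LE (unit_vec a) 0 (e1 a); rewrite normr0 q0 !subr0 => /(_ ler01) h.
  by apply: le_trans h _; rewrite ler_piMr.
have dq a b : `|q (unit_vec a) - q (unit_vec b)| <= L * `|a - b|.
  by apply: le_trans (LE _ _ (e1 _) (e1 _)) _; rewrite ler_wpM2l // unit_vec_lipschitz.
have le2 (x y B C : R) : 0 <= x -> 0 <= y -> x <= B -> y <= C -> 2 * x * y <= 2 * (B * C).
  by move=> x0 y0 xB yC; rewrite -mulrA ler_pM2l // ler_pM.
exists (4 * L); split; first by rewrite mulr_ge0.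
- move=> a; apply: le_trans (normr_dot_le _ _) _.
  have := le2 _ _ _ _ (normr_ge0 _) (normr_ge0 _) (e1 a) (qe a); lra.
- move=> a b.
  have -> : f a - f b = dot (unit_vec a - unit_vec b) (q (unit_vec a)) +
      dot (unit_vec b) (q (unit_vec a) - q (unit_vec b)).
    by rewrite /f /radial /dot /=; ring.
  apply: le_trans (ler_normD _ _) _.
  have h1 := le2 _ _ _ _ (normr_ge0 _) (normr_ge0 _) (unit_vec_lipschitz a b) (qe a).
  have h2 := le2 _ _ _ _ (normr_ge0 _) (normr_ge0 _) (e1 b) (dq a b).
  have := normr_dot_le (unit_vec a - unit_vec b) (q (unit_vec a)).
  have := normr_dot_le (unit_vec b) (q (unit_vec a) - q (unit_vec b)).
  lra.
move=> a b.
have -> : g a - g b = cross (unit_vec a - unit_vec b) (q (unit_vec a)) +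
    cross (unit_vec b) (q (unit_vec a) - q (unit_vec b)).
  by rewrite /g /angular /cross /=; ring.
apply: le_trans (ler_normD _ _) _.
have h1 := le2 _ _ _ _ (normr_ge0 _) (normr_ge0 _) (unit_vec_lipschitz a b) (qe a).
have h2 := le2 _ _ _ _ (normr_ge0 _) (normr_ge0 _) (e1 b) (dq a b).
have := normr_cross_le (unit_vec a - unit_vec b) (q (unit_vec a)).
have := normr_cross_le (unit_vec b) (q (unit_vec a) - q (unit_vec b)).
lra.
Qed.

(** The angle and the logarithm of the radius of the homogeneous system, in the time
that makes the angular equation autonomous. *)
Lemma angular_flow (M th0 : R) :
  (forall a b, `|f a - f b| <= M * `|a - b|) -> (forall a b, `|g a - g b| <= M * `|a - b|) ->
  exists Th y : R -> R, [/\ Th 0 = th0, forall t : R, is_derive t 1 Th (g (Th t)) &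
    forall t : R, is_derive t 1 y (f (Th t))].
Proof.
move=> fM gM.
have [|w w0 dw] := @lipschitz_global_solution R (fun p => (g p.1, f p.1)) M (th0, 0).
  move=> p p'; rewrite prod_norm_le /=.
  have h : `|p.1 - p'.1| <= `|p - p'| := prod_norm_fst (p - p').
  have M0 : 0 <= M.
    by have := fM 1 0; rewrite subr0 normr1 mulr1; apply: le_trans.
  by rewrite (le_trans (gM _ _)) ?(le_trans (fM _ _)) // ler_wpM2l.
exists (fun t => (w t).1), (fun t => (w t).2); split; first by rewrite w0.
  by move=> t; have /is_derive_pairE[] := dw t.
by move=> t; have /is_derive_pairE[] := dw t.
Qed.

(** This is the solution e^y e_Th of the homogeneous system, brought back to the
original one: r is its radius and clock its time.  Derivatives are with respect
to the time of the angular equation, for which the field is divided by r^m. *)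
Lemma polar_orbit (Th y S : R -> R) (t : R) : 0 < S t ->
  is_derive t 1 Th (g (Th t)) -> is_derive t 1 y (f (Th t)) ->
  is_derive t 1 S (expR (- (m%:R * y t))) ->
  let clock s := ln (mu * S s) / mu in
  let r s := expR (lam * clock s + y s) in
  [/\ r t ^+ m = mu * (S t * expR (m%:R * y t)),
      is_derive t 1 clock (r t ^+ m)^-1 &
      is_derive t 1 (fun s => r s *: unit_vec (Th s)) ((r t ^+ m)^-1 *: F (r t *: unit_vec (Th t)))].
Proof.
move=> S0 dTh dy dS clock r.
have mu0 : 0 < mu by rewrite mulr_gt0 // ltr0n.
have muS : 0 < mu * S t by rewrite mulr_gt0.
have rm : r t ^+ m = mu * (S t * expR (m%:R * y t)).
  rewrite /r -expRM_natl mulrDr.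
  have -> : m%:R * (lam * clock t) = ln (mu * S t).
    by rewrite /clock /mu; field; rewrite pnatr_eq0 -lt0n m_gt0 gt_eqF.
  by rewrite expRD lnK ?posrE // mulrA.
have dclock : is_derive t 1 clock (r t ^+ m)^-1.
  have dmuS : is_derive t 1 (fun s => mu * S s) (mu * expR (- (m%:R * y t))).
    by apply: is_derive_eq; rewrite -![_ *: _]/(_ * _); ring.
  have dln : is_derive (mu * S t) 1 (@ln R) (mu * S t)^-1 by exact: is_derive1_ln.
  have ? : is_derive t 1 (fun s => ln (mu * S s)) ((mu * S t)^-1 * (mu * expR (- (m%:R * y t)))).
    exact: is_derive1_comp.
  apply: is_derive_eq; rewrite -![_ *: _]/(_ * _) rm expRN.
  have e0 := expR_gt0 (m%:R * y t).
  by field; rewrite !gt_eqF.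
split => //.
have r0 : 0 < r t by exact: expR_gt0.
set d := (r t ^+ m)^-1 in dclock *.
have dE : d * r t ^+ m.+1 = r t.
  by rewrite exprSr mulrA mulVf ?mul1r // gt_eqF // exprn_gt0.
have dr : is_derive t 1 r (r t * (lam * d + f (Th t))).
  by apply: is_derive_eq; rewrite -![_ *: _]/(_ * _) /r; ring.
have -> : d *: F (r t *: unit_vec (Th t)) =
    (d * lam * r t) *: unit_vec (Th t) + r t *: q (unit_vec (Th t)).
  rewrite /F /star_field (q_hom _ _ (ltW r0)) scalerDr !scalerA.
  by rewrite dE ?mulrA.
have dcos : is_derive t 1 (fun s => cos (Th s)) (- sin (Th t) * g (Th t)).
  exact: (@is_derive1_comp R cos Th).
have dsin : is_derive t 1 (fun s => sin (Th s)) (cos (Th t) * g (Th t)).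
  exact: (@is_derive1_comp R sin Th).
have cs := cos2Dsin2 (Th t).
move: dcos dsin dr cs; rewrite /f /g /radial /angular /dot /cross /unit_vec /=.
set C := cos (Th t); set Sn := sin (Th t); case: (q (C, Sn)) => q1 q2 /= dcos dsin dr cs.
apply/is_derive_pairE; split; apply: is_derive_eq; rewrite /= -![_ *: _]/(_ * _) -/C -/Sn.
  have -> : r t * q1 = r t * ((C ^+ 2 + Sn ^+ 2) * q1) by rewrite cs mul1r.
  ring.
have -> : r t * q2 = r t * ((C ^+ 2 + Sn ^+ 2) * q2) by rewrite cs mul1r.
ring.
Qed.

End AncientOrbits.

Section AttractingCurve.
Context {R : realType} (lam : R) (m : nat) (q : R * R -> R * R).
Hypothesis lam_gt0 : 0 < lam.
Hypothesis m_gt0 : (0 < m)%N.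
Hypothesis q_hom : positively_homogeneous m.+1 q.
Hypothesis q_lip : locally_lipschitz q.

Let F := star_field lam q.
Let mu : R := m%:R * lam.
Local Notation f := (radial q).
Local Notation g := (angular q).

(** The constants do not depend on the direction, since they are those of
dissipation_bound and of angular_data_lipschitz. *)
Lemma ancient_orbits (ths : R) : g ths = 0 -> (forall th, g th = 0 -> f th < 0) ->
  exists a b : R, 0 < a /\ forall th0, exists v r0, [/\ 0 < r0, v 0 = r0 *: unit_vec th0,
    forall t : R, is_derive t 1 v (F (v t)) & forall t, a <= `|v t| <= b].
Proof.
move=> gs fneg.
have mu0 : 0 < mu by rewrite mulr_gt0 // ltr0n.
have [M [M0 fM fL gL]] := angular_data_lipschitz m q q_hom q_lip.
have cf := lipschitz_continuous f M fL.
have cg := lipschitz_continuous g M gL.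
pose the := ths + pi *+ 2.
have pi0 := pi_ge0 R.
have ge : g the = 0 by rewrite /g /angular unit_vecD2pi.
have [||c [A [c0 A0 fcA]]] := @dissipation_bound R f g ths the _ cf cg.
- by rewrite /the mulr2n; lra.
- by move=> x _; exact: fneg.
pose K := A * (the - ths).
pose c1 := expR (- (m%:R * M)); pose c2 := expR (m%:R * K) / (m%:R * c).
have c10 : 0 < c1 by exact: expR_gt0.
have c20 : 0 < c2 by rewrite divr_gt0 ?expR_gt0 // mulr_gt0 // ltr0n.
pose lo := Num.min 1 (mu * c1); pose hi := Num.max 1 (mu * c2).
have lo0 : 0 < lo by rewrite lt_min ltr01 mulr_gt0.
have hi0 : 0 <= hi by rewrite le_max ler01.
exists (lo / 2), hi; split; first by rewrite divr_gt0.
move=> th0.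
have [th thin uE] := @angle_exists_from R ths (unit_vec th0) (dot_unit_vec th0).
have [Th [y [Th0 dTh dy]]] := angular_flow q M th fL gL.
have trap t : ths <= Th t <= the.
  by apply: (@trapped_flow R g Th M ths the t M0 gL dTh gs ge); rewrite Th0.
have yhi := @dissipative_along_flow R f g Th y M ths the c A M0 gL cg dTh dy trap A0 fcA.
have ylo s t : s <= t -> - M * (t - s) <= y t - y s.
  move=> st.
  have := @derive_nondecreasing R (fun r => y r + M * r) (fun r => f (Th r) + M) s t st.
  have H1 r : s <= r <= t -> is_derive r 1 (fun r => y r + M * r) (f (Th r) + M).
    by move=> _; have ? := dy r; apply: is_derive_eq; rewrite -![_ *: _]/(_ * _); ring.
  move=> /(_ H1) H; have : y s + M * s <= y t + M * t.
    by apply: H => r _; have := fM (Th r); rewrite ler_norml => /andP[? _]; lra.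
  lra.
have cy : continuous y by move=> t; apply: is_derive_continuous; exact: dy.
have [S dS SE] := ancient_clock y m M c K m_gt0 c0 M0 cy ylo yhi.
have S0 t : 0 < S t.
  rewrite -(@pmulr_lgt0 _ (expR (m%:R * y t))) ?expR_gt0 //.
  by apply: lt_le_trans c10 _; case/andP: (SE t).
pose clock s := ln (mu * S s) / mu.
pose r s := expR (lam * clock s + y s).
have orbit t := polar_orbit lam m q lam_gt0 m_gt0 q_hom Th y S t (S0 t) (dTh t) (dy t) (dS t).
have r0 t : 0 < r t by exact: expR_gt0.
have rm t : mu * c1 <= r t ^+ m <= mu * c2.
  by have [-> _ _] := orbit t; rewrite !ler_pM2l.
have rE t : lo <= r t <= hi by exact: (expr_bounds (r t) _ _ m m_gt0 (ltW (r0 t)) (rm t)).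
have rm0 t : 0 < r t ^+ m by rewrite exprn_gt0.
have dclock (t : R) : is_derive t 1 clock (r t ^+ m)^-1 by case: (orbit t).
pose X t := r t *: unit_vec (Th t).
have XE t : lo / 2 <= `|X t| <= hi.
  rewrite normrZ (gtr0_norm (r0 t)).
  have /andP[h1 h2] := rE t; have /andP[h3 h4] := normr_unit_vec (Th t).
  apply/andP; split; first by rewrite ler_pM // ltW.
  by rewrite -[X in _ <= X]mulr1 ler_pM // ltW.
have dX (t : R) : is_derive t 1 X ((r t ^+ m)^-1 *: F (X t)) by case: (orbit t).
have FL := star_field_lipschitz lam q lam_gt0 q_lip.
(* X is not parametrized by time: the solution v through X 0 satisfies
   v (clock t - clock 0) = X t, because both sides solve the same equation
   with the bounded weight clock'. *)
have [v v0 dv] := truncated_solution F hi (X 0) FL hi0.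
have [L L0 LE] := FL hi.
have dclock0 (t : R) : is_derive t 1 (fun s => clock s - clock 0) (r t ^+ m)^-1.
  by have ? := dclock t; apply: is_derive_eq; rewrite subr0.
have vX t : v (clock t - clock 0) = X t.
  apply/eqP; rewrite -subr_eq0; apply/eqP.
  apply: (@gronwall_plane_eq0 R setT (fun s => v (clock s - clock 0) - X s)
    (fun s => (r s ^+ m)^-1 *: (F (clamp hi (v (clock s - clock 0))) - F (X s)))
    ((mu * c1)^-1 * L) 0) => //.
  - move=> s _; rewrite scalerBr.
    have d1 := is_derive_comp_plane v _ s _ _ (dv (clock s - clock 0)) (dclock0 s).
    have ? := dX s.
    exact: (@is_deriveB _ _ _ (fun s => v (clock s - clock 0)) X s 1).
  - move=> s _; rewrite normrZ -mulrA ler_pM //.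
      rewrite gtr0_norm ?invr_gt0 // lef_pV2 ?posrE ?(mulr_gt0 mu0 c10) //.
      by case/andP: (rm s).
    have /andP[_ Xs] := XE s.
    have := LE (clamp hi (v (clock s - clock 0))) (X s) (clamp_bounded _ _ hi0) Xs.
    move=> h; apply: le_trans h _; rewrite ler_wpM2l //.
    by rewrite -{1}(clamp_id hi (X s) Xs) clamp_lipschitz.
  - by rewrite mulr_ge0 // invr_ge0 (ltW (mulr_gt0 mu0 c10)).
  - by rewrite subrr v0 subrr.
(* The speed of the clock is bounded below, so all times are reached. *)
have surj (T : R) : exists t, clock t - clock 0 = T.
  have ds s : (mu * c2)^-1 <= (r s ^+ m)^-1.
    by rewrite lef_pV2 ?posrE ?(mulr_gt0 mu0 c20) //; case/andP: (rm s).
  have grow a b : a <= b -> (mu * c2)^-1 * (b - a) <= clock b - clock a.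
    move=> ab.
    have := @derive_nondecreasing R (fun s => clock s - (mu * c2)^-1 * s)
      (fun s => (r s ^+ m)^-1 - (mu * c2)^-1) a b ab.
    have H1 s : a <= s <= b -> is_derive s 1 (fun s => clock s - (mu * c2)^-1 * s)
       ((r s ^+ m)^-1 - (mu * c2)^-1).
      by move=> _; have ? := dclock s; apply: is_derive_eq; rewrite -![_ *: _]/(_ * _); ring.
    move=> /(_ H1) H; have : clock a - (mu * c2)^-1 * a <= clock b - (mu * c2)^-1 * b.
      by apply: H => s _; have := ds s; lra.
    lra.
  pose N := `|T| * (mu * c2).
  have N0 : 0 <= N by rewrite mulr_ge0 // (ltW (mulr_gt0 mu0 c20)).
  have NE : (mu * c2)^-1 * N = `|T| by rewrite /N mulrCA mulVf ?mulr1 // gt_eqF // (mulr_gt0 mu0 c20).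
  apply: (@continuous_crossing R _ (- N) N).
    by move=> s; apply: is_derive_continuous; exact: dclock0.
  have h1 : (mu * c2)^-1 * (0 - - N) <= clock 0 - clock (- N) by apply: grow; lra.
  have h2 := grow 0 N N0.
  rewrite sub0r opprK NE in h1; rewrite subr0 NE in h2.
  have := ler_norm T; have := ler_norm (- T); rewrite normrN => ? ?.
  by apply/andP; split; lra.
have vE t : lo / 2 <= `|v t| <= hi.
  by have [s <-] := surj t; rewrite vX.
exists v, (r 0); split => //.
  by rewrite v0 /X Th0 uE.
by move=> t; have := dv t; rewrite clamp_id //; case/andP: (vE t).
Qed.

End AttractingCurve.

(** * The attracting curve *)

Definition bounded_orbits {R : realType} (F : R * R -> R * R) (a b : R) : set (R * R) :=
  [set p | exists v : R -> R * R, [/\ v 0 = p, forall t : R, is_derive t 1 v (F (v t)) &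
    forall t, a <= `|v t| <= b]].

Lemma bounded_orbits_invariant {R : realType} (F : R * R -> R * R) (a b : R) :
  locally_lipschitz F -> solution_invariant F (bounded_orbits F a b).
Proof.
move=> FL I u solu s t Is It [v [v0 dv vE]].
have solv : solution F setT v by split => //; exact: openT.
have solvs := solution_shift F setT v s solv.
have uv : u t = v (t - s).
  by apply: (@solution_unique R F I _ u (fun r => v (r - s)) s t FL solu solvs) => //; rewrite subrr.
exists (fun r => v (r + (t - s))); split; first by rewrite add0r uv.
  move=> r; have := @is_derive_shift_arg R v (s - t) r (F (v (r + (t - s)))).
  by rewrite opprB; apply; exact: dv.
by move=> r; exact: vE.
Qed.

Lemma continuous_dependence {R : realType} (G : R * R -> R * R) (L : R) (u v : R -> R * R) (t : R) :
  0 <= L -> (forall p q, `|G p - G q| <= L * `|p - q|) ->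
  (forall s : R, is_derive s 1 u (G (u s))) -> (forall s : R, is_derive s 1 v (G (v s))) ->
  `|u t - v t| ^+ 2 <= 2 * `|u 0 - v 0| ^+ 2 * expR (4 * L * `|t|).
Proof.
move=> L0 GL du dv; rewrite -[X in expR (_ * `|X|)]subr0.
by apply: (@gronwall_plane R setT (fun s => u s - v s) (fun s => G (u s) - G (v s)) L 0 t).
Qed.

(** Limits of points of the set have orbits that are approximated, at each time, by
orbits in the annulus.  The truncated field provides a solution through the limit
point without knowing beforehand that it stays in the annulus. *)
Lemma bounded_orbits_closed {R : realType} (F : R * R -> R * R) (a b : R) : 0 <= b ->
  locally_lipschitz F -> closed (bounded_orbits F a b).
Proof.
move=> b0 FL p clp.
have [L L0 LE] := FL b.
have GL x y : `|F (clamp b x) - F (clamp b y)| <= L * `|x - y|.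
  apply: le_trans (LE _ _ (clamp_bounded _ _ b0) (clamp_bounded _ _ b0)) _.
  by rewrite ler_wpM2l // clamp_lipschitz.
have [v v0 dv] := truncated_solution F b p FL b0.
have approx t e : 0 < e -> exists2 w : R * R, a <= `|w| <= b & `|v t - w| < e.
  move=> e0.
  pose E := expR (4 * L * `|t|); have E0 : 0 < E by exact: expR_gt0.
  (* Since d <= 1, d^2 <= d, and 2 d^2 E < e^2. *)
  pose d := Num.min 1 (e ^+ 2 / (4 * E)).
  have d0 : 0 < d by rewrite lt_min ltr01 divr_gt0 ?exprn_gt0 // mulr_gt0.
  have [p' [[v' [v'0 dv' v'E]] pp']] := clp _ (nbhsx_ballx p d d0).
  rewrite -ball_normE /= in pp'.
  have dv'G (s : R) : is_derive s 1 v' (F (clamp b (v' s))).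
    by have := dv' s; rewrite clamp_id //; case/andP: (v'E s).
  exists (v' t) => //.
  have := @continuous_dependence R (fun x => F (clamp b x)) L v v' t L0 GL dv dv'G.
  rewrite v0 v'0 -/E => h.
  have d1 : d <= 1 by rewrite ge_min lexx.
  have dE : d <= e ^+ 2 / (4 * E) by rewrite ge_min lexx orbT.
  have h2 : `|p - p'| ^+ 2 < e ^+ 2 / (4 * E).
    apply: lt_le_trans dE; apply: (@le_lt_trans _ _ `|p - p'|); last exact: pp'.
    by rewrite expr2 ler_piMr // (le_trans (ltW pp')).
  rewrite -(@ltr_pXn2r _ 2) ?nnegrE ?(ltW e0) //.
  apply: le_lt_trans h _.
  rewrite ltr_pdivlMr ?mulr_gt0 // in h2.
  by have := exprn_gt0 2 e0; lra.
have vE t : a <= `|v t| <= b.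
  apply/andP; split; rewrite leNgt; apply/negP => lt.
    have [|w /andP[aw _] vw] := approx t (a - `|v t|); first by rewrite subr_gt0.
    by have := lerB_dist w (v t); rewrite distrC; lra.
  have [|w /andP[_ wb] vw] := approx t (`|v t| - b); first by rewrite subr_gt0.
  by have := lerB_dist (v t) w; lra.
exists v; split => // t.
by have := dv t; rewrite clamp_id //; case/andP: (vE t).
Qed.

Lemma bounded_orbits_punctured {R : realType} (F : R * R -> R * R) (a b : R) : 0 < a -> 0 <= b ->
  locally_lipschitz F -> punctured_compact (bounded_orbits F a b).
Proof.
move=> a0 b0 FL; split; first exact: bounded_orbits_closed.
  by exists b => p [v [<- _ vE]]; case/andP: (vE 0).
move=> [v [v0 _ vE]]; have := vE 0; rewrite v0 normr0 => /andP[]; lra.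
Qed.

Lemma euclidean_normZ {R : realType} (k : R) (p : R * R) : 0 <= k -> euclidean_norm (k *: p) = k * euclidean_norm p.
Proof.
move=> k0; rewrite /euclidean_norm /dot /= -![_ *: _]/(_ * _).
have -> : k * p.1 * (k * p.1) + k * p.2 * (k * p.2) = k ^+ 2 * dot p p by rewrite /dot; ring.
by rewrite sqrtrM ?sqr_ge0 // sqrtr_sqr ger0_norm.
Qed.

Lemma euclidean_norm_unit_vec {R : realType} (th : R) : euclidean_norm (unit_vec th) = 1.
Proof. by rewrite /euclidean_norm dot_unit_vec sqrtr1. Qed.

Lemma polar_form {R : realType} (p : R * R) : p != 0 ->
  exists2 th : R, 0 <= th <= pi *+ 2 & p = euclidean_norm p *: unit_vec th.
Proof.
move=> p0; have N0 := euclidean_norm_gt0 p p0.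
have [|th th02 E] := @angle_exists R ((euclidean_norm p)^-1 *: p).
  have -> : dot ((euclidean_norm p)^-1 *: p) ((euclidean_norm p)^-1 *: p) = (euclidean_norm p)^-1 ^+ 2 * dot p p.
    by rewrite /dot /= -![_ *: _]/(_ * _); ring.
  by rewrite -sqr_euclidean_norm -exprMn mulVf ?expr1n // gt_eqF.
by exists th => //; rewrite E scalerA mulfV ?scale1r // gt_eqF.
Qed.

Lemma unit_vec_inj {R : realType} (a b : R) : 0 <= a < pi *+ 2 -> 0 <= b < pi *+ 2 ->
  unit_vec a = unit_vec b -> a = b.
Proof.
wlog ab : a b / b <= a.
  move=> H a0 b0 E; have [ba|/ltW ab] := leP b a; first exact: H.
  by apply/esym/H.
move=> /andP[a0 a2] /andP[b0 b2] [Ec Es].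
have cd : cos (a - b) = 1 by rewrite cosB Ec Es -!expr2 cos2Dsin2.
have p0 := pi_gt0 R.
have [dpi|dpi] := leP (a - b) pi.
  have : a - b = 0.
    by apply: cos_inj; rewrite ?in_itv /= ?cos0 // ?lexx ?subr_ge0 ?ab ?(ltW p0).
  lra.
have : pi *+ 2 - (a - b) = 0.
  rewrite mulr2n in a2 b2 *.
  apply: cos_inj; rewrite ?in_itv /= ?cos0 ?lexx ?(ltW p0) //; first by lra.
  by rewrite -mulr2n addrC cosD2pi cosN.
by rewrite mulr2n in a2 *; lra.
Qed.

Lemma bounded_closed_compact {R : realType} (C : set (R * R)) (B : R) :
  closed C -> (forall p, C p -> `|p| <= B) -> compact C.
Proof.
move=> clC CB; apply: (@subclosed_compact _ C (`[- B, B] `*` `[- B, B])) => //.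
  by apply: compact_setX; exact: segment_compact.
move=> p /CB; rewrite prod_norm_le !ler_norml => /andP[h1 h2].
by split; rewrite /= in_itv.
Qed.

(** The curve is the point gam(th) of C on the ray of angle th.  It is continuous
because C is compact: the points of C away from a neighbourhood of gam(th) are
not on the ray of th, hence, uniformly, not on the rays of nearby angles. *)
Lemma star_shaped_closed_curve {R : realType} (C : set (R * R)) : punctured_compact C ->
  (forall p (kap : R), C p -> C (kap *: p) -> 0 < kap -> kap = 1) ->
  (forall e : R * R, e != 0 -> exists2 kap : R, 0 < kap & C (kap *: e)) ->
  simple_closed_curve C.
Proof.
move=> [clC [B CB] C0] once meets.
have /choice[rho rhoE] : forall th : R, exists r : R, 0 < r /\ C (r *: unit_vec th).
  by move=> th; have [r r0 Cr] := meets _ (unit_vec_neq0 th); exists r.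
pose gam th := rho th *: unit_vec th.
have Cg th : C (gam th) by case: (rhoE th).
have same_ray p th r : C p -> 0 < r -> p = r *: unit_vec th -> p = gam th.
  move=> Cp r0 pE.
  have [rho0 _] := rhoE th.
  have : p = (r / rho th) *: gam th by rewrite /gam scalerA divfK // gt_eqF.
  move=> E; rewrite E (once (gam th) (r / rho th)) ?scale1r ?divr_gt0 //.
  by rewrite -E.
have cgam : continuous gam.
  move=> th U /= nU.
  have cptC : compact C by exact: bounded_closed_compact CB.
  have cptK : compact (C `&` ~` U^°).
    apply: (@subclosed_compact _ _ C) => //; apply: closedI => //.
    by apply: open_closedC; exact: open_interior.
  have := (compact_near_coveringP _).1 cptK R (nbhs th)
    (fun th' p => euclidean_norm p - dot (unit_vec th') p > 0) _ => H.
  have : \forall th' \near th, (C `&` ~` U^°) `<=` (fun p => euclidean_norm p - dot (unit_vec th') p > 0).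
    apply: H => p [Cp nUp].
    have p0 : p != 0 by apply: contraPneq Cp => ->.
    have lt : 0 < euclidean_norm p - dot (unit_vec th) p.
      rewrite subr_gt0 -[X in _ < X]mul1r -(euclidean_norm_unit_vec th).
      apply: dot_lt_euclidean_norm => //; first exact: unit_vec_neq0.
      move=> r r0; apply/eqP => pE; apply: nUp.
      by rewrite (same_ray p th r Cp r0 pE); exact: nU.
    have c0 : (fun z : (R * R) * R => euclidean_norm z.1) @ filter_prod (nbhs p) (nbhs th) --> euclidean_norm p.
      by apply: (cvg_comp _ _ cvg_fst); exact: euclidean_norm_continuous.
    have c1 : (fun z : (R * R) * R => z.1.1) @ filter_prod (nbhs p) (nbhs th) --> p.1.
      by apply: (cvg_comp _ _ cvg_fst); exact: cvg_fst.
    have c2 : (fun z : (R * R) * R => z.1.2) @ filter_prod (nbhs p) (nbhs th) --> p.2.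
      by apply: (cvg_comp _ _ cvg_fst); exact: cvg_snd.
    have c3 : (fun z : (R * R) * R => cos z.2) @ filter_prod (nbhs p) (nbhs th) --> cos th.
      by apply: (cvg_comp _ _ cvg_snd); exact: continuous_cos.
    have c4 : (fun z : (R * R) * R => sin z.2) @ filter_prod (nbhs p) (nbhs th) --> sin th.
      by apply: (cvg_comp _ _ cvg_snd); exact: continuous_sin.
    have c5 : (fun z : (R * R) * R => euclidean_norm z.1 - dot (unit_vec z.2) z.1)
        @ filter_prod (nbhs p) (nbhs th) --> euclidean_norm p - dot (unit_vec th) p.
      by apply: cvgB => //; apply: cvgD; apply: cvgM.
    exact: (@cvgr_gt _ _ _ _ _ _ c5 0 lt).
  apply: filterS => th' sub; apply: contrapT => nU'.
  have [rho0 _] := rhoE th'.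
  have /sub : (C `&` ~` U^°) (gam th').
    by split; [exact: Cg|move=> /interior_subset].
  rewrite /gam euclidean_normZ ?(ltW rho0) // euclidean_norm_unit_vec mulr1.
  have -> : dot (unit_vec th') (rho th' *: unit_vec th') = rho th' * dot (unit_vec th') (unit_vec th').
    by rewrite /dot /= -![_ *: _]/(_ * _); ring.
  by rewrite dot_unit_vec mulr1 subrr ltxx.
have pi2 : 0 < pi *+ 2 :> R by rewrite mulrn_wgt0 // pi_gt0.
exists (fun x => gam (x * (pi *+ 2))); split.
- apply: continuous_subspaceT => x.
  have cm : (fun x : R => x * (pi *+ 2)) @ x --> x * (pi *+ 2).
    by apply: cvgM; [exact: cvg_id|exact: cvg_cst].
  exact: (cvg_comp _ _ cm (cgam _)).
- have E : unit_vec (1 * (pi *+ 2)) = unit_vec (0 * (pi *+ 2) : R).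
    by rewrite mul1r mul0r -[pi *+ 2]add0r unit_vecD2pi.
  have [r0 _] := rhoE (0 * (pi *+ 2)).
  by apply: (same_ray _ _ _ (Cg _) r0); rewrite E.
- move=> x y; rewrite !in_itv /= => /andP[x0 x1] /andP[y0 y1] E.
  have [rx _] := rhoE (x * (pi *+ 2)); have [ry _] := rhoE (y * (pi *+ 2)).
  have rxy : rho (x * (pi *+ 2)) = rho (y * (pi *+ 2)).
    have := congr1 euclidean_norm E; rewrite /gam !euclidean_normZ ?(ltW rx) ?(ltW ry) //.
    by rewrite !euclidean_norm_unit_vec !mulr1.
  apply: (mulIf (lt0r_neq0 pi2)); apply: unit_vec_inj.
  + by rewrite mulr_ge0 ?(ltW pi2) //= -[X in _ < X]mul1r ltr_pM2r.
  + by rewrite mulr_ge0 ?(ltW pi2) //= -[X in _ < X]mul1r ltr_pM2r.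
  + move: E; rewrite /gam rxy => /(congr1 (GRing.scale (rho (y * (pi *+ 2)))^-1)).
    by rewrite !scalerA mulVf ?scale1r // gt_eqF.
apply/seteqP; split=> [p Cp|p [x _ <-]]; last exact: Cg.
have p0 : p != 0 by apply: contraPneq Cp => ->.
have [th /andP[th0 th2] pE] := polar_form p p0.
exists (th / (pi *+ 2)).
  rewrite /= in_itv /= divr_ge0 ?(ltW pi2) //=.
  by rewrite ler_pdivrMr // mul1r.
rewrite divfK ?gt_eqF //; apply/esym.
exact: (same_ray p th (euclidean_norm p) Cp (euclidean_norm_gt0 _ p0) pE).
Qed.

(** * Polynomial vector fields *)

Definition polynomial_map {R : realType} (Q1 Q2 : bipoly R) (p : R * R) : R * R :=
  (eval2 Q1 p, eval2 Q2 p).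

Lemma eval2E {R : realType} (Q : bipoly R) (p : R * R) :
  eval2 Q p = \sum_(k <- msupp Q) mcoeff k Q * (p.1 ^+ k ord0 * p.2 ^+ k ord_max).
Proof.
rewrite /eval2 mevalE; apply: eq_bigr => k _.
rewrite !big_ord_recl big_ord0 mulr1 !(tnth_nth 0) /=.
by have -> : lift ord0 ord0 = ord_max :> 'I_2 by apply/val_inj.
Qed.

Lemma eval2_homogeneous {R : realType} (n : nat) (Q : bipoly R) (c : R) (p : R * R) :
  homogeneous n Q -> eval2 Q (c *: p) = c ^+ n * eval2 Q p.
Proof.
move=> /dhomogP hQ; rewrite !eval2E big_distrr /=.
rewrite big_seq [RHS]big_seq; apply: eq_bigr => k kQ.
have := hQ k kQ; rewrite /= mdegE !big_ord_recl big_ord0 addn0.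
have -> : lift ord0 ord0 = ord_max :> 'I_2 by apply/val_inj.
by move=> <-; rewrite exprD -![_ *: _]/(_ * _) !exprMn; ring.
Qed.

Lemma eval2N {R : realType} (Q : bipoly R) (p : R * R) : eval2 (- Q) p = - eval2 Q p.
Proof. by rewrite /eval2 mevalN. Qed.

Lemma locally_lipschitz_cst {R : realType} (c : R) : locally_lipschitz (fun _ : R * R => c).
Proof. by move=> B; exists 0 => // p q _ _; rewrite subrr normr0 mul0r. Qed.

Lemma locally_lipschitzD {R : realType} (h k : R * R -> R) :
  locally_lipschitz h -> locally_lipschitz k -> locally_lipschitz (fun p => h p + k p).
Proof.
move=> hL kL B; have [L L0 LE] := hL B; have [M M0 ME] := kL B.
exists (L + M) => [|p q pB qB]; first exact: addr_ge0.
rewrite opprD addrACA mulrDl; apply: le_trans (ler_normD _ _) _.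
by rewrite lerD ?LE ?ME.
Qed.

Lemma locally_lipschitzM {R : realType} (h k : R * R -> R) :
  locally_lipschitz h -> locally_lipschitz k -> locally_lipschitz (fun p => h p * k p).
Proof.
move=> hL kL B; have [L L0 LE] := hL B; have [M M0 ME] := kL B.
have [B0|B0] := leP 0 B; last first.
  by exists 0 => // p q pB; have := normr_ge0 p; lra.
have bd (l : R * R -> R) (K : R) : 0 <= K ->
    (forall p q, `|p| <= B -> `|q| <= B -> `|l p - l q| <= K * `|p - q|) ->
    forall p, `|p| <= B -> `|l p| <= `|l 0| + K * B.
  move=> K0 KE p pB.
  have := KE p 0 pB; rewrite normr0 subr0 => /(_ B0) h1.
  have := ler_normD (l p - l 0) (l 0); rewrite subrK => h2.
  by have := ler_wpM2l K0 pB; lra.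
pose H := `|h 0| + L * B; pose K := `|k 0| + M * B.
have H0 : 0 <= H by rewrite addr_ge0 // mulr_ge0.
have K0 : 0 <= K by rewrite addr_ge0 // mulr_ge0.
exists (H * M + L * K) => [|p q pB qB]; first by rewrite addr_ge0 // mulr_ge0.
have -> : h p * k p - h q * k q = h p * (k p - k q) + (h p - h q) * k q by ring.
apply: le_trans (ler_normD _ _) _; rewrite !normrM mulrDl -!mulrA.
rewrite lerD //.
  by rewrite ler_pM // ?ME //; exact: (bd h L).
by rewrite [K * _]mulrC mulrA ler_pM // ?LE //; exact: (bd k M).
Qed.

Lemma locally_lipschitzX {R : realType} (h : R * R -> R) (n : nat) :
  locally_lipschitz h -> locally_lipschitz (fun p => h p ^+ n).
Proof.
move=> hL; elim: n => [|n IH]; first exact: locally_lipschitz_cst.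
rewrite (_ : (fun p => h p ^+ n.+1) = (fun p => h p * h p ^+ n)); last first.
  by apply/funext => p; rewrite exprS.
exact: locally_lipschitzM.
Qed.

(** A polynomial function is built from the coordinates by sums and products. *)
Lemma eval2_lipschitz {R : realType} (Q : bipoly R) : locally_lipschitz (eval2 Q).
Proof.
rewrite (funext (eval2E Q)).
have fstL : locally_lipschitz (fun p : R * R => p.1).
  by move=> B; exists 1 => // p q _ _; rewrite mul1r (prod_norm_fst (p - q)).
have sndL : locally_lipschitz (fun p : R * R => p.2).
  by move=> B; exists 1 => // p q _ _; rewrite mul1r (prod_norm_snd (p - q)).
elim: (msupp Q : seq _) => [|k s IH].
  rewrite (_ : (fun p => _) = (fun _ => 0)); first exact: locally_lipschitz_cst.
  by apply/funext => p; rewrite big_nil.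
rewrite (_ : (fun p => _) = (fun p => mcoeff k Q * (p.1 ^+ k ord0 * p.2 ^+ k ord_max) +
  \sum_(k <- s) mcoeff k Q * (p.1 ^+ k ord0 * p.2 ^+ k ord_max))); last first.
  by apply/funext => p; rewrite big_cons.
apply: locally_lipschitzD IH; apply: locally_lipschitzM; first exact: locally_lipschitz_cst.
by apply: locally_lipschitzM; apply: locally_lipschitzX.
Qed.

Lemma polynomial_map_lipschitz {R : realType} (Q1 Q2 : bipoly R) : locally_lipschitz (polynomial_map Q1 Q2).
Proof.
move=> B; have [L L0 LE] := eval2_lipschitz Q1 B; have [M M0 ME] := eval2_lipschitz Q2 B.
exists (L + M) => [|p q pB qB]; first exact: addr_ge0.
rewrite prod_norm_le /= mulrDl; apply/andP; split.
  by apply: le_trans (LE p q pB qB) _; rewrite lerDl mulr_ge0.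
by apply: le_trans (ME p q pB qB) _; rewrite lerDr mulr_ge0.
Qed.

Lemma polynomial_map_homogeneous {R : realType} (n : nat) (Q1 Q2 : bipoly R) :
  homogeneous n Q1 -> homogeneous n Q2 ->
  forall (c : R) p, polynomial_map Q1 Q2 (c *: p) = c ^+ n *: polynomial_map Q1 Q2 p.
Proof. by move=> h1 h2 c p; rewrite /polynomial_map !(eval2_homogeneous n). Qed.

(** On the circle at infinity the compactified field is g times the unit tangent
vector. *)
Lemma infinite_equilibriumE {R : realType} (lam : R) (n : nat) (Q1 Q2 : bipoly R) (th : R) :
  infinite_equilibrium lam n Q1 Q2 th <-> angular (polynomial_map Q1 Q2) th = 0.
Proof.
rewrite /infinite_equilibrium /poincare_field /angular /cross /polynomial_map /=.
have cs := cos2Dsin2 th.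
rewrite cs subrr sqrtr0 expr0n /= !mulr0 !mul0r !add0r.
set C := cos th in cs *; set S := sin th in cs *.
set a := eval2 Q1 _; set b := eval2 Q2 _.
have -> : a - (C * a + S * b) * C = - S * (C * b - S * a).
  have -> : a - (C * a + S * b) * C = (C ^+ 2 + S ^+ 2) * a - (C * a + S * b) * C.
    by rewrite cs mul1r.
  by ring.
have -> : b - (C * a + S * b) * S = C * (C * b - S * a).
  have -> : b - (C * a + S * b) * S = (C ^+ 2 + S ^+ 2) * b - (C * a + S * b) * S.
    by rewrite cs mul1r.
  by ring.
split=> [[E1 E2]|->]; last by rewrite !mulr0.
have : (C ^+ 2 + S ^+ 2) * (C * b - S * a) = C * (C * (C * b - S * a)) - S * (- S * (C * b - S * a)) by ring.
by rewrite cs mul1r E1 E2 !mulr0 subrr.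
Qed.

(** * Polycycles when lam is positive *)

Lemma simple_closed_curve_compact {R : realType} (C : set (R * R)) :
  simple_closed_curve C -> compact C.
Proof.
move=> [c [cc _ _ ->]]; apply: (continuous_compact cc); exact: segment_compact.
Qed.

Lemma curve_punctured_compact {R : realType} (C : set (R * R)) :
  simple_closed_curve C -> ~ C 0 -> punctured_compact C.
Proof.
move=> /simple_closed_curve_compact cC C0; split => //.
  by apply: compact_closed => //; exact: norm_hausdorff.
have [B [_ BE]] := compact_bounded cC.
by exists (B + 1) => p Cp; apply: (BE (B + 1)) => //; rewrite ltrDl.
Qed.

Section PolycycleTheory.
Context {R : realType} (lam : R) (m : nat) (q : R * R -> R * R).
Hypothesis lam_gt0 : 0 < lam.
Hypothesis m_gt0 : (0 < m)%N.
Hypothesis q_hom : forall (c : R) p, q (c *: p) = c ^+ m.+1 *: q p.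
Hypothesis q_lip : locally_lipschitz q.

Let q_hom0 : positively_homogeneous m.+1 q. Proof. by move=> c p _; exact: q_hom. Qed.

Local Notation F := (star_field lam q).

Lemma dotZ (k l : R) (p p' : R * R) : dot (k *: p) (l *: p') = k * l * dot p p'.
Proof. by rewrite /dot /= -![_ *: _]/(_ * _); ring. Qed.

Lemma crossZ (k l : R) (p p' : R * R) : cross (k *: p) (l *: p') = k * l * cross p p'.
Proof. by rewrite /cross /= -![_ *: _]/(_ * _); ring. Qed.

Lemma crossD (p x y : R * R) : cross p (x + y) = cross p x + cross p y.
Proof. by rewrite /cross /=; ring. Qed.

Lemma dotD (p x y : R * R) : dot p (x + y) = dot p x + dot p y.
Proof. by rewrite /dot /=; ring. Qed.

Lemma crossxx (p : R * R) : cross p p = 0.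
Proof. by rewrite /cross; ring. Qed.

Lemma polycycle_meets_every_ray (C : set (R * R)) (e : R * R) : polycycle F C -> e != 0 ->
  exists2 kap : R, 0 < kap & C (kap *: e).
Proof.
move=> [curveC invC _ C0] e0.
have pcC := curve_punctured_compact C curveC C0.
have FL := star_field_lipschitz lam q lam_gt0 q_lip.
have inv := (flow_invariantE F C FL).1 invC.
apply: (closed_curve_meets_every_ray C e curveC C0) => // p kap.
exact: (invariant_meets_ray_once lam m q lam_gt0 m_gt0 q_hom0 q_lip C p kap pcC inv).
Qed.

Lemma polycycle_attracting (C : set (R * R)) : polycycle F C -> globally_attracting F C.
Proof.
move=> pC I u traj [t0 It0 ut0].
have [curveC invC _ C0] := pC.
have pcC := curve_punctured_compact C curveC C0.
have FL := star_field_lipschitz lam q lam_gt0 q_lip.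
have inv := (flow_invariantE F C FL).1 invC.
apply: (invariant_attracting lam m q lam_gt0 m_gt0 q_hom0 q_lip C I u t0 pcC inv) => // e.
exact: polycycle_meets_every_ray.
Qed.

Lemma equilibrium_of_zero (C : set (R * R)) (th kap : R) :
  punctured_compact C -> solution_invariant F C -> C (kap *: unit_vec th) ->
  angular q th = 0 -> F (kap *: unit_vec th) = 0.
Proof.
move=> pcC inv Ck gth.
apply: (invariant_ray_equilibrium lam m q lam_gt0 m_gt0 q_hom q_lip C) => //.
by rewrite q_hom crossZ -/(angular q th) gth mulr0.
Qed.

(** At the equilibrium kap e_th on the polycycle, lam kap + f(th) kap^n = 0. *)
Lemma polycycle_radial_lt0 (C : set (R * R)) (th : R) : polycycle F C ->
  angular q th = 0 -> radial q th < 0.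
Proof.
move=> pC gth.
have [curveC invC _ C0] := pC.
have pcC := curve_punctured_compact C curveC C0.
have FL := star_field_lipschitz lam q lam_gt0 q_lip.
have inv := (flow_invariantE F C FL).1 invC.
have [kap kap0 Ck] := polycycle_meets_every_ray C _ pC (unit_vec_neq0 th).
have := equilibrium_of_zero C th kap pcC inv Ck gth.
rewrite /star_field q_hom => /(congr1 (dot (1 *: unit_vec th))).
rewrite dotD scalerA !dotZ dot_unit_vec -/(radial q th) !mul1r mulr1.
have -> : dot (1 *: unit_vec th) 0 = 0 by rewrite /dot /=; ring.
have : 0 < kap ^+ m.+1 by rewrite exprn_gt0.
have : 0 < lam * kap by rewrite mulr_gt0.
move=> h1 h2 h3; rewrite -(@pmulr_rlt0 _ (kap ^+ m.+1)) //; lra.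
Qed.

(** The direction of the equilibrium on the polycycle. *)
Lemma polycycle_angular_zero (C : set (R * R)) : polycycle F C -> exists th, angular q th = 0.
Proof.
move=> [_ _ [p Cp Fp] C0].
have p0 : p != 0 by apply: contraPneq Cp => ->.
have [th _ pE] := polar_form p p0.
have N0 := euclidean_norm_gt0 p p0.
exists th; move: Fp; rewrite /star_field pE q_hom => /(congr1 (cross (1 *: unit_vec th))).
rewrite crossD scalerA !crossZ crossxx mulr0 add0r mul1r -/(angular q th).
have -> : cross (1 *: unit_vec th) 0 = 0 by rewrite /cross /=; ring.
by move/eqP; rewrite mulf_eq0 expf_eq0 /= gt_eqF //= => /eqP.
Qed.

(** The polycycle is the set of the points whose orbits stay in an annulus, and its
equilibrium is the point in the direction ths, in which g vanishes. *)
Lemma polycycle_exists (ths : R) : angular q ths = 0 ->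
  (forall th, angular q th = 0 -> radial q th < 0) -> exists C, polycycle F C.
Proof.
move=> gs fneg.
have FL := star_field_lipschitz lam q lam_gt0 q_lip.
have [a [b [a0 orbits]]] := ancient_orbits lam m q lam_gt0 m_gt0 q_hom0 q_lip ths gs fneg.
have b0 : 0 <= b.
  have [v [r0 [_ _ _ vE]]] := orbits 0; have := vE 0; have := normr_ge0 (v 0).
  by lra.
pose C := bounded_orbits F a b.
have pcC : punctured_compact C by exact: bounded_orbits_punctured.
have inv : solution_invariant F C by exact: bounded_orbits_invariant.
have once := invariant_meets_ray_once lam m q lam_gt0 m_gt0 q_hom0 q_lip C _ _ pcC inv.
have meets (e : R * R) : e != 0 -> exists2 kap : R, 0 < kap & C (kap *: e).
  move=> e0; have [th _ eE] := polar_form e e0.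
  have N0 := euclidean_norm_gt0 e e0.
  have [v [r0 [r00 v0 dv vE]]] := orbits th.
  exists (r0 / euclidean_norm e); first by rewrite divr_gt0.
  rewrite eE euclidean_normZ ?euclidean_norm_unit_vec ?mulr1 ?(ltW N0) // scalerA divfK ?gt_eqF //.
  by exists v.
exists C; split.
- by apply: star_shaped_closed_curve => // p kap; exact: once.
- exact/(flow_invariantE F C FL).
- have [kap kap0 Ck] := meets _ (unit_vec_neq0 ths).
  exists (kap *: unit_vec ths) => //.
  exact: (equilibrium_of_zero C).
- by case: pcC.
Qed.

End PolycycleTheory.

(** * Time reversal *)

Definition reversed_field {R : realType} (F : R * R -> R * R) (p : R * R) : R * R := - F p.

Lemma reversed_fieldK {R : realType} (F : R * R -> R * R) :
  reversed_field (reversed_field F) = F.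
Proof. by apply/funext => p; rewrite /reversed_field opprK. Qed.

Lemma is_derive_reversed {R : realType} (u : R -> R * R) (t : R) (l : R * R) :
  is_derive (- t) 1 u l -> is_derive t 1 (fun s => u (- s)) (- l).
Proof.
by move=> du; rewrite -scaleN1r; apply: (is_derive_comp_plane u -%R).
Qed.

Lemma solution_reversed {R : realType} (F : R * R -> R * R) (I : set R) (u : R -> R * R) :
  solution F I u -> solution (reversed_field F) [set t | I (- t)] (fun t => u (- t)).
Proof.
move=> [oI itvI du]; split.
- by apply: (@open_comp _ _ -%R I) => // t _; exact: oppr_continuous.
- by move=> x y /= Ix Iy z /andP[xz zy]; apply: (itvI _ _ Iy Ix); rewrite !lerN2 zy xz.
- by move=> t /= It; apply: is_derive_reversed; exact: du.
Qed.

Lemma trajectory_reversed {R : realType} (F : R * R -> R * R) (I : set R) (u : R -> R * R) :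
  trajectory F I u -> trajectory (reversed_field F) [set t | I (- t)] (fun t => u (- t)).
Proof.
move=> [[t0 It0] solu umax]; split; first by exists (- t0); rewrite /= opprK.
  exact: solution_reversed.
move=> J v solv IJ vu t Jt.
have := solution_reversed _ _ _ solv; rewrite reversed_fieldK => solv'.
apply: (umax _ _ solv') => /=; last by rewrite opprK.
  by move=> s Is /=; apply: IJ; rewrite /= opprK.
by move=> s Is; rewrite vu /= ?opprK.
Qed.

Lemma polycycle_reversed {R : realType} (F : R * R -> R * R) (C : set (R * R)) :
  polycycle F C -> polycycle (reversed_field F) C.
Proof.
move=> [curveC invC [p Cp Fp] C0]; split => //; last first.
  by exists p => //; rewrite /reversed_field Fp oppr0.
move=> I u traj s t Is It.
have := trajectory_reversed _ _ _ traj; rewrite reversed_fieldK => traj'.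
have := invC _ _ traj' (- s) (- t); rewrite /= !opprK; exact.
Qed.

Lemma globally_attracting_reversed {R : realType} (F : R * R -> R * R) (C : set (R * R)) :
  globally_attracting (reversed_field F) C -> globally_repelling F C.
Proof.
move=> attr I u traj [t0 It0 ut0].
have [|[M [Mr IM]] near_C] := attr _ _ (trajectory_reversed _ _ _ traj).
  by exists (- t0); rewrite /= opprK.
split; first by exists (- M); split; [rewrite realN|move=> t tM; have := IM (- t); rewrite /= opprK; apply; rewrite ltrNr].
move=> e e0; have [N [Nr NE]] := near_C e e0.
exists (- N); split; first by rewrite realN.
move=> t tN; have := NE (- t); rewrite opprK; apply; by rewrite ltrNr.
Qed.

Lemma reversed_system {R : realType} (lam : R) (Q1 Q2 : bipoly R) :
  reversed_field (system_field lam Q1 Q2) = system_field (- lam) (- Q1) (- Q2).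
Proof.
apply/funext => p; rewrite /reversed_field /system_field !eval2N !mulNr -!opprD.
by [].
Qed.

Section PositiveSystem.
Context {R : realType} (lam : R) (n : nat) (Q1 Q2 : bipoly R).
Hypothesis lam_gt0 : 0 < lam.
Hypothesis n_gt1 : (1 < n)%N.
Hypothesis Q1_homog : homogeneous n Q1.
Hypothesis Q2_homog : homogeneous n Q2.

Lemma positive_polycycle (C : set (R * R)) : polycycle (system_field lam Q1 Q2) C ->
  [/\ exists th, angular_part Q1 Q2 th = 0,
      forall th, angular_part Q1 Q2 th = 0 -> radial_part Q1 Q2 th < 0 &
      globally_attracting (system_field lam Q1 Q2) C].
Proof.
case: n n_gt1 Q1_homog Q2_homog => [|m] // m0 h1 h2 pC.
have q_hom := polynomial_map_homogeneous _ _ _ h1 h2; have q_lip := polynomial_map_lipschitz Q1 Q2.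
split.
- exact: (polycycle_angular_zero lam m (polynomial_map Q1 Q2) q_hom C pC).
- move=> th; exact: (polycycle_radial_lt0 lam m (polynomial_map Q1 Q2) lam_gt0 m0 q_hom q_lip C th pC).
- exact: (polycycle_attracting lam m (polynomial_map Q1 Q2) lam_gt0 m0 q_hom q_lip C pC).
Qed.

Lemma positive_polycycle_exists (ths : R) : angular_part Q1 Q2 ths = 0 ->
  (forall th, angular_part Q1 Q2 th = 0 -> radial_part Q1 Q2 th < 0) ->
  exists C, polycycle (system_field lam Q1 Q2) C.
Proof.
case: n n_gt1 Q1_homog Q2_homog => [|m] // m0 h1 h2.
have q_hom := polynomial_map_homogeneous _ _ _ h1 h2; have q_lip := polynomial_map_lipschitz Q1 Q2.
exact: (polycycle_exists lam m (polynomial_map Q1 Q2) lam_gt0 m0 q_hom q_lip).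
Qed.

End PositiveSystem.

Lemma angular_partN {R : realType} (Q1 Q2 : bipoly R) (th : R) :
  angular_part (- Q1) (- Q2) th = - angular_part Q1 Q2 th.
Proof. by rewrite /angular_part !eval2N; ring. Qed.

Lemma radial_partN {R : realType} (Q1 Q2 : bipoly R) (th : R) :
  radial_part (- Q1) (- Q2) th = - radial_part Q1 Q2 th.
Proof. by rewrite /radial_part !eval2N; ring. Qed.

Lemma homogeneousN {R : realType} (n : nat) (Q : bipoly R) :
  homogeneous n Q -> homogeneous n (- Q).
Proof. by rewrite /homogeneous => h; rewrite rpredN. Qed.

Lemma polycycle_necessary {R : realType} (lam : R) (n : nat) (Q1 Q2 : bipoly R) (C : set (R * R)) :
  lam != 0 -> (1 < n)%N -> homogeneous n Q1 -> homogeneous n Q2 ->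
  polycycle (system_field lam Q1 Q2) C ->
  [/\ exists th, angular_part Q1 Q2 th = 0,
      forall th, angular_part Q1 Q2 th = 0 -> lam * radial_part Q1 Q2 th < 0,
      0 < lam -> globally_attracting (system_field lam Q1 Q2) C &
      lam < 0 -> globally_repelling (system_field lam Q1 Q2) C].
Proof.
rewrite neq_lt => /orP[lam_lt0|lam_gt0] n1 h1 h2 pC.
  have := polycycle_reversed _ _ pC; rewrite reversed_system => pC'.
  have nlam : 0 < - lam by rewrite oppr_gt0.
  have [[th gth] fneg attr] := positive_polycycle (- lam) n (- Q1) (- Q2) nlam n1
    (homogeneousN _ _ h1) (homogeneousN _ _ h2) C pC'.
  split.
  - by exists th; move: gth; rewrite angular_partN => /eqP; rewrite oppr_eq0 => /eqP.
  - move=> t gt; have := fneg t; rewrite angular_partN gt oppr0 radial_partN => /(_ erefl).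
    by rewrite oppr_lt0 => ?; rewrite nmulr_rlt0.
  - by move=> lam_gt0; have := lt_trans lam_gt0 lam_lt0; rewrite ltxx.
  - by move=> _; apply: globally_attracting_reversed; rewrite reversed_system.
have [gth fneg attr] := positive_polycycle lam n Q1 Q2 lam_gt0 n1 h1 h2 C pC.
split => //.
- by move=> t gt; rewrite pmulr_rlt0 //; exact: fneg.
- by move=> lam_lt0; have := lt_trans lam_gt0 lam_lt0; rewrite ltxx.
Qed.

Lemma polycycle_sufficient {R : realType} (lam : R) (n : nat) (Q1 Q2 : bipoly R) (ths : R) :
  lam != 0 -> (1 < n)%N -> homogeneous n Q1 -> homogeneous n Q2 ->
  angular_part Q1 Q2 ths = 0 ->
  (forall th, angular_part Q1 Q2 th = 0 -> lam * radial_part Q1 Q2 th < 0) ->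
  exists C, polycycle (system_field lam Q1 Q2) C.
Proof.
rewrite neq_lt => /orP[lam_lt0|lam_gt0] n1 h1 h2 gs fneg; last first.
  apply: (positive_polycycle_exists lam n Q1 Q2 lam_gt0 n1 h1 h2 ths gs) => th gth.
  by have := fneg th gth; rewrite pmulr_rlt0.
have nlam : 0 < - lam by rewrite oppr_gt0.
have [||C pC] := positive_polycycle_exists (- lam) n (- Q1) (- Q2) nlam n1
    (homogeneousN _ _ h1) (homogeneousN _ _ h2) ths.
- by rewrite angular_partN gs oppr0.
- move=> th; rewrite angular_partN radial_partN => /eqP; rewrite oppr_eq0 => /eqP gth.
  by have := fneg th gth; rewrite nmulr_rlt0 // oppr_lt0.
exists C; have := polycycle_reversed _ _ pC.
by rewrite reversed_system !opprK.
Qed.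

(** * The characterization of polycycles *)

Lemma unit_vecDpi {R : realType} (th : R) : unit_vec (th + pi) = -1 *: unit_vec th.
Proof. by rewrite /unit_vec cosDpi sinDpi scaleN1r. Qed.

Lemma angular_partDpi {R : realType} (n : nat) (Q1 Q2 : bipoly R) (th : R) :
  homogeneous n Q1 -> homogeneous n Q2 ->
  angular_part Q1 Q2 (th + pi) = - (-1) ^+ n * angular_part Q1 Q2 th.
Proof.
move=> h1 h2; rewrite /angular_part unit_vecDpi !(eval2_homogeneous n) // cosDpi sinDpi.
by ring.
Qed.

Lemma radial_partDpi {R : realType} (n : nat) (Q1 Q2 : bipoly R) (th : R) :
  homogeneous n Q1 -> homogeneous n Q2 ->
  radial_part Q1 Q2 (th + pi) = - (-1) ^+ n * radial_part Q1 Q2 th.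
Proof.
move=> h1 h2; rewrite /radial_part unit_vecDpi !(eval2_homogeneous n) // cosDpi sinDpi.
by ring.
Qed.

Theorem proposition5p7 (R : realType) (lam : R) (n : nat) (Q1 Q2 : bipoly R)
  (lam_neq0 : lam != 0) (n_gt1 : (1 < n)%N)
  (Q1_neq0 : Q1 != 0) (Q2_neq0 : Q2 != 0)
  (Q1_homog : homogeneous n Q1) (Q2_homog : homogeneous n Q2) :
  ((exists C : set (R * R), polycycle (system_field lam Q1 Q2) C) <->
     [/\ odd n,
         exists th : R, infinite_equilibrium lam n Q1 Q2 th /\
                        infinite_equilibrium lam n Q1 Q2 (th + pi) &
         forall th : R, angular_part Q1 Q2 th = 0 ->
                        lam * radial_part Q1 Q2 th < 0]) /\
  (forall C : set (R * R), polycycle (system_field lam Q1 Q2) C ->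
     (0 < lam -> globally_attracting (system_field lam Q1 Q2) C) /\
     (lam < 0 -> globally_repelling (system_field lam Q1 Q2) C)).
Proof.
have infE th : infinite_equilibrium lam n Q1 Q2 th <-> angular_part Q1 Q2 th = 0.
  exact: infinite_equilibriumE.
split; last first.
  by move=> C /(polycycle_necessary _ _ _ _ _ lam_neq0 n_gt1 Q1_homog Q2_homog)[].
split=> [[C]|[_ [th [/infE gth _]] fneg]]; last first.
  exact: (polycycle_sufficient lam n Q1 Q2 th).
move=> /(polycycle_necessary _ _ _ _ _ lam_neq0 n_gt1 Q1_homog Q2_homog)[[th gth] fneg _ _].
have gthpi : angular_part Q1 Q2 (th + pi) = 0.
  by rewrite (angular_partDpi n) // gth mulr0.
split => //; last by exists th; split; apply/infE.
apply: contraT => n_even.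
have := fneg _ gthpi; have := fneg _ gth.
rewrite (radial_partDpi n) // -signr_odd (negbTE n_even) expr0 mulN1r mulrN oppr_lt0.
by move=> h1 h2; have := lt_trans h1 h2; rewrite ltxx.
Qed.
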